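(* For every $x>0$ and $\mu>0$, $$E[\tau(x)A(x)]=\frac{x^3}{2\mu^2}+\frac{x^2}{\mu^3}+\frac{x}{\mu^4}.$$
   Context: Let $B_t$ be a standard one-dimensional Brownian motion ($B_0=0$). For $x>0$ and $\mu>0$ let $X(t)=x-\mu t+B_t$. The first-passage time below zero is $\tau(x)=\inf\{t>0: X(t)\le 0\}$ (finite almost surely), and the first-passage area is $A(x)=\int_0^{\tau(x)}X(t)\,dt$. *)

(* Defs.v *)
From HB Require Import structures.
From mathcomp Require Import all_boot all_order all_algebra.
From mathcomp Require Import all_classical all_reals all_analysis.
Import Order.TTheory GRing.Theory Num.Theory.
Import numFieldNormedType.Exports.

Set Implicit Arguments.
Unset Strict Implicit.
Unset Printing Implicit Defensive.

Local Open Scope classical_set_scope.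
Local Open Scope ring_scope.

(* The product rule for subfamilies follows by taking some [C i] to be [setT]. *)
Definition mutually_independent (d : measure_display) (T : measurableType d)
    (R : realType) (P : probability T R) (I : finType) (X : I -> T -> R) : Prop :=
  forall C : I -> set R, (forall i, measurable (C i)) ->
    P (\bigcap_i (X i @^-1` C i)) = (\prod_i P (X i @^-1` C i))%E.

(* A process is indexed by the whole of [R], but only its values at
   nonnegative times matter. [normal_prob m s] takes the standard deviation [s],
   and its value for [s = 0] is not a Dirac mass, hence [s < t] below. *)
Record standard_brownian_motion (d : measure_display) (T : measurableType d)
    (R : realType) (P : probability T R) (B : R -> {RV P >-> R}) : Prop := {
  sbm_start : {ae P, forall w, B 0 w = 0} ;
  sbm_independent_increments : forall t : R^nat,
    0 <= t 0%N -> nondecreasing_seq t ->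
    forall n, mutually_independent P
      (fun (i : 'I_n) w => B (t i.+1) w - B (t i) w) ;
  sbm_gaussian_increments : forall s t : R, 0 <= s -> s < t ->
    forall C : set R, measurable C ->
      pushforward P (B t \- B s) C = normal_prob 0 (Num.sqrt (t - s)) C ;
  sbm_continuous_paths :
    {ae P, forall w, {within `[0, +oo[, continuous (fun t : R => B t w)}} }.

(* [+oo] when the path [Y] never meets the half-line below zero. *)
Definition first_passage_time (R : realType) (Y : R -> R) : \bar R :=
  ereal_inf [set t%:E | t in [set t : R | (0 < t)%R /\ (Y t <= 0)%R]].

Definition first_passage_area (R : realType) (Y : R -> R) : \bar R :=
  (\int[lebesgue_measure]_(t in [set t : R | (0 <= t)%R /\ t%:E <= first_passage_time Y])
     (Y t)%:E)%E.

Definition drifted_path (d : measure_display) (T : measurableType d)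
    (R : realType) (P : probability T R) (B : R -> {RV P >-> R})
    (x mu : R) (w : T) : R -> R :=
  fun t => x - mu * t + B t w.

(* Main.v *)
Require Import Defs.
From HB Require Import structures.
From mathcomp Require Import all_boot all_order all_algebra.
From mathcomp Require Import all_classical all_reals all_analysis.
From mathcomp Require Import measurable_realfun archimedean.
From mathcomp Require Import ring lra zify.
Import Order.TTheory GRing.Theory Num.Theory.
Import numFieldNormedType.Exports.

Set Implicit Arguments.
Unset Strict Implicit.
Unset Printing Implicit Defensive.

Local Open Scope classical_set_scope.
Local Open Scope ring_scope.

(* Let f(y) = E A(y), g(y) = E tau(y) and v(y) = E (tau(y) A(y)). By the Markov
   property t A_t + t f(X_t) + A_t g(X_t) + v(X_t), where A_t is the area up to
   time t, is a martingale; it is a polynomial, starts at v(x) and equals tau A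
   at time tau. To stop it, the path is sampled at the times k 2^-n: the sampled
   walk has an exact martingale of the same form, whose stopping only involves
   finitely many increments. As n tends to infinity its stopped values converge
   to sigma A', with sigma the first time the path is negative and A' the area up
   to sigma. Dominated convergence applies because
   sup_t (|B_t - B_0| - mu t / 2) has an exponential tail, and it bounds the
   passage time, the area and the overshoot polynomially. Finally tau and sigma
   need not be compared for the same x: sigma A' for a starting point y < x is
   at most tau A for x, which is at most sigma A' for x, and v is continuous. *)

(** The polynomials of the overview vanish at 0 and solve g''/2 - mu g' = -1, f''/2 - mu f' = -y and
    v''/2 - mu v' = -(f + y g), whence g(y) = y / mu and f(y) = y^2 / (2 mu) + y / (2 mu^2). Two
    obstacles shape the proof. Independence is only given for finitely many increments, so stopping
    is carried out for a Markov chain driven by those of one grid, without continuous-time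
    filtrations. And proving tau = sigma almost surely would require that the path become negative
    at once after reaching 0. Moving the starting point avoids this, and it also avoids the
    measurability of tau and A, which is never established: the integral is monotone for arbitrary
    nonnegative functions, so a squeeze between almost sure limits of measurable functions
    determines it. *)

Section integral_density.
Local Open Scope ereal_scope.
Context d (T : measurableType d) (R : realType).
Variables (mu nu : {measure set T -> \bar R}) (p : T -> R).
Hypotheses (p0 : forall x, (0 <= p x)%R) (mp : measurable_fun setT p).
Hypothesis nuE : forall A, measurable A -> nu A = \int[mu]_(x in A) (p x)%:E.

Import HBNNSimple.

Let density_indic E : measurable E ->
  \int[nu]_x (\1_E x)%:E = \int[mu]_x ((\1_E x)%:E * (p x)%:E).
Proof.
move=> mE; rewrite integral_indic//= setIT nuE// integral_mkcond/=.
apply: eq_integral => x _; rewrite patchE indicE.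
by case: ifPn => _; rewrite ?mul1e ?mul0e.
Qed.

Let density_nnsfun (f : {nnsfun T >-> R}) :
  \int[nu]_x (f x)%:E = \int[mu]_x ((f x)%:E * (p x)%:E).
Proof.
under [LHS]eq_integral do rewrite fimfunE -fsumEFin//.
rewrite [LHS]ge0_integral_fsum//; last 2 first.
  - by move=> r; exact/measurable_EFinP/measurableT_comp.
  - by move=> n x _; rewrite EFinM nnfun_muleindic_ge0.
under [RHS]eq_integral.
  move=> x xD; rewrite fimfunE -fsumEFin// ge0_mule_fsuml; last first.
    by move=> r; rewrite EFinM nnfun_muleindic_ge0.
  over.
rewrite [RHS]ge0_integral_fsum//; last 2 first.
  - move=> r; apply: emeasurable_funM; last exact/measurable_EFinP.
    by apply/measurable_EFinP; do 2 apply/measurableT_comp => //.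
  - by move=> n x _; apply: mule_ge0; [exact: nnfun_muleindic_ge0|rewrite lee_fin].
apply: eq_fsbigr => r rf.
rewrite integralZl_indic_nnsfun//= density_indic//.
have [r0|r0] := leP 0%R r.
  rewrite -ge0_integralZl//; last 2 first.
    apply: emeasurable_funM; last exact/measurable_EFinP.
    by apply/measurable_EFinP/measurable_indic/measurable_sfunP.
    by move=> x _; rewrite mule_ge0// lee_fin.
  by apply: eq_integral => x _; rewrite EFinM muleA.
move: rf; rewrite inE => -[x _ fx]; have : (0 <= f x)%R by exact: fun_ge0.
by rewrite fx leNgt r0.
Qed.

Lemma ge0_integral_density (f : T -> \bar R) :
  measurable_fun setT f -> (forall x, 0 <= f x) ->
  \int[nu]_x f x = \int[mu]_x (f x * (p x)%:E).
Proof.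
move=> mf f0; pose f_ := nnsfun_approx measurableT mf.
transitivity (lim (\int[nu]_x (f_ n x)%:E @[n --> \oo])).
  rewrite -monotone_convergence//=.
  - apply: eq_integral => x _; apply/esym/cvg_lim => //=.
    exact: cvg_nnsfun_approx.
  - by move=> n; exact/measurable_EFinP.
  - by move=> n ? _; rewrite lee_fin.
  - by move=> ? _ ? ? mn; rewrite lee_fin; exact/lefP/nd_nnsfun_approx.
transitivity (lim (\int[mu]_x ((f_ n x)%:E * (p x)%:E) @[n --> \oo])).
  by apply: congr_lim; apply/funext => n /=; exact: density_nnsfun.
rewrite -monotone_convergence//=.
- apply: eq_integral => x _.
  have cf : (f_ n x)%:E @[n --> \oo] --> f x by exact: cvg_nnsfun_approx.
  by apply/cvg_lim => //; exact: cvgeZr.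
- by move=> n; apply: emeasurable_funM; exact/measurable_EFinP.
- by move=> n ? _; rewrite mule_ge0// lee_fin.
- move=> x _ a b ab; apply: lee_wpmul2r; first by rewrite lee_fin.
  by rewrite lee_fin; exact/lefP/nd_nnsfun_approx.
Qed.

Let funepos_density (f : T -> \bar R) :
  (fun x => f x * (p x)%:E)^\+ = (fun x => f^\+ x * (p x)%:E).
Proof.
apply/funext => x; rewrite !funeposE [in RHS]muleC maxe_pMr ?lee_fin//.
by rewrite mule0 muleC.
Qed.

Lemma integrable_density (f : T -> \bar R) :
  nu.-integrable setT f -> mu.-integrable setT (fun x => f x * (p x)%:E).
Proof.
move=> /integrableP[mf foo]; apply/integrableP; split.
  by apply: emeasurable_funM => //; exact/measurable_EFinP.
rewrite ge0_integral_density// in foo; last exact: measurableT_comp.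
congr (_ < _)%E: foo; apply: eq_integral => x _.
by rewrite abseM; congr (_ * _); rewrite gee0_abs// lee_fin.
Qed.

Lemma integral_density (f : T -> \bar R) :
  nu.-integrable setT f -> \int[nu]_x f x = \int[mu]_x (f x * (p x)%:E).
Proof.
move=> /integrableP[mf _]; rewrite integralE [RHS]integralE.
rewrite !ge0_integral_density//; last 2 first.
  exact: measurable_funeneg.
  exact: measurable_funepos.
congr (_ - _); apply: eq_integral => x _.
  by rewrite funepos_density.
rewrite -funeposN -[in RHS]funeposN -[LHS]/((fun x => (\- f)^\+ x * (p x)%:E) x).
by rewrite -funepos_density; congr (_^\+ _); apply/funext => y; rewrite mulNe.
Qed.

End integral_density.

(** * Gaussian moments *)

Section derivative_integral.
Context {R : realType}.
Local Notation leb := (@lebesgue_measure R).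

(** The fundamental theorem of calculus on [-n, n] followed by dominated convergence. Applied to
    polynomials times the normal density, it replaces integration by parts on the line. *)
Lemma integral_derivative_vanishing (F f : R -> R) :
  (forall x : R, is_derive x 1 F (f x)) -> continuous f ->
  leb.-integrable setT (EFin \o f) ->
  F n%:R @[n --> \oo] --> (0 : R) -> F (- n%:R) @[n --> \oo] --> (0 : R) ->
  (\int[leb]_x (f x)%:E = 0)%E.
Proof.
move=> dF cf intf Fy FNy.
have cF : continuous F.
  by move=> x; apply/differentiable_continuous/derivable1_diffP; case: (dF x).
pose f_ n x := (f x * \1_`[- n%:R, n%:R] x)%:E.
have mf : measurable_fun setT f by exact: continuous_measurable_fun.
have [|||||_ _] := @dominated_convergence _ _ _ leb setT measurableT f_
  (EFin \o f) (EFin \o (Num.norm \o f)).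
- by move=> n; apply/measurable_EFinP/measurable_funM => //; exact: measurable_indic.
- exact/measurable_EFinP.
- apply/aeW => x _; apply: cvg_near_cst; near=> n.
  rewrite /f_ indicE mem_set ?mulr1//= in_itv/= -ler_norml.
  by near: n; exact: nbhs_infty_ger.
- exact: integrable_norm.
- apply/aeW => x n _; rewrite /f_/= lee_fin normrM indicE.
  by case: (_ \in _); rewrite ?normr1 ?normr0 ?mulr1 ?mulr0.
move=> cvf; apply/esym/(cvg_unique _ _ cvf) => //.
have FE n : (0 < n)%N ->
    (\int[leb]_x f_ n x = (F n%:R - F (- n%:R))%:E)%E.
  move=> n0; have nn : - n%:R < n%:R :> R by rewrite gtrN// ltr0n.
  rewrite EFinB -(continuous_FTC2 (f := f) nn).
  - rewrite [RHS]integral_mkcond; apply: eq_integral => x _.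
    by rewrite patchE /f_ indicE; case: ifP => _; rewrite ?mulr1 ?mulr0.
  - exact: continuous_subspaceT.
  - split; first by move=> x _; case: (dF x).
    + exact/cvg_at_right_filter/cF.
    + exact/cvg_at_left_filter/cF.
  - by move=> x _; rewrite derive1E; case: (dF x) => _ ->.
have : F n%:R - F (- n%:R) @[n --> \oo] --> (0 : R).
  by rewrite -[X in _ --> X](subr0 0); exact: cvgB.
move=> /(cvg_comp _ EFin) => /(_ (nbhs (0%:E : \bar R))) FFy.
apply: cvg_trans (FFy _); last by move=> A.
apply: near_eq_cvg; near=> n; rewrite /= FE//.
by near: n; exact: nbhs_infty_gt.
Unshelve. all: by end_near. Qed.

End derivative_integral.

Section gaussian_moments.
Context {R : realType} (s : R) (s0 : 0 < s).
Local Notation leb := (@lebesgue_measure R).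
Local Notation N := (normal_prob 0 s).
Local Notation p := (normal_pdf 0 s).

Let sN0 : s != 0. Proof. by rewrite gt_eqF. Qed.

(** Cubing [1 + u / 3 <= expR (u / 3)] produces the term u^3 / 27, hence the constant. *)
Lemma cube_le_expR (u : R) : 0 <= u -> 1 + u ^+ 3 <= 27 * expR u.
Proof.
move=> u0; have -> : u = 3%:R * (u / 3) by field.
rewrite expRM_natl.
have : (1 + u / 3) ^+ 3 <= expR (u / 3) ^+ 3.
  rewrite lerXn2r ?nnegrE ?expR_ge0 ?expR_ge1Dx//.
  by rewrite addr_ge0// divr_ge0.
nra.
Qed.

Lemma ge0_integral_normal_prob (f : R -> \bar R) :
  measurable_fun setT f -> (forall x, 0 <= f x)%E ->
  (\int[N]_x f x = \int[leb]_x (f x * (p x)%:E))%E.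
Proof.
move=> mf f0; apply: ge0_integral_density => //.
- exact: normal_pdf_ge0.
- exact: measurable_normal_pdf.
Qed.

Lemma integral_normal_prob (f : R -> \bar R) : N.-integrable setT f ->
  (\int[N]_x f x = \int[leb]_x (f x * (p x)%:E))%E.
Proof.
apply: integral_density => //.
- exact: normal_pdf_ge0.
- exact: measurable_normal_pdf.
Qed.

Lemma normal_mgf (t : R) :
  (\int[N]_y (expR (t * y))%:E = (expR (t ^+ 2 * s ^+ 2 / 2))%:E)%E.
Proof.
have mE : measurable_fun setT (fun y : R => expR (t * y)).
  by apply: measurableT_comp => //; exact: measurable_funM.
rewrite ge0_integral_normal_prob; last 2 first.
  exact/measurable_EFinP.
  by move=> x; rewrite lee_fin expR_ge0.
(* Completing the square: the exponential tilts the density into the normal one of mean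
   [t * s ^+ 2]. *)
under eq_integral => y _.
  have -> : ((expR (t * y))%:E * (p y)%:E =
     (expR (t ^+ 2 * s ^+ 2 / 2))%:E * (normal_pdf (t * s ^+ 2) s y)%:E)%E.
    rewrite -!EFinM; congr (_%:E); rewrite !normal_pdfE//.
    rewrite mulrCA [RHS]mulrCA; congr (_ * _); rewrite /normal_fun -!expRD.
    by congr expR; field.
  over.
rewrite ge0_integralZl//=; last 2 first.
  by apply/measurable_EFinP; exact: measurable_normal_pdf.
  by move=> x _; rewrite lee_fin normal_pdf_ge0.
by rewrite integral_normal_pdf mule1.
Qed.

Lemma integrable_normal_expR (t : R) :
  N.-integrable setT (fun y => (expR (t * y))%:E).
Proof.
apply/integrableP; split.
  apply/measurable_EFinP.
  by apply: measurableT_comp => //; exact: measurable_funM.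
under eq_integral do rewrite gee0_abs ?lee_fin ?expR_ge0//.
by rewrite normal_mgf ltry.
Qed.

(** |y|^k <= 1 + |y|^3 <= 27 exp |y| <= 27 (exp y + exp (-y)), and both exponentials are integrable
    by [normal_mgf]. *)
Lemma integrable_normal_exprn k : (k <= 3)%N ->
  N.-integrable setT (fun y => (y ^+ k)%:E).
Proof.
move=> k3.
have ig : N.-integrable setT
    ((fun y : R => (27%R%:E * (expR (1 * y))%:E)%E) \+
     (fun y : R => (27%R%:E * (expR (- 1 * y))%:E)%E))%E.
  by apply: integrableD => //; apply: integrableZl => //;
    exact: integrable_normal_expR.
apply: le_integrable ig => //.
- by apply/measurable_EFinP; exact: measurable_funX.
- move=> y _; rewrite -!EFinM -EFinD !abse_EFin lee_fin mul1r mulN1r normrX.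
  rewrite [leRHS]ger0_norm ?addr_ge0 ?mulr_ge0 ?expR_ge0//.
  apply: (@le_trans _ _ (1 + `|y| ^+ 3)).
    have [y1|y1] := leP `|y| 1.
      by rewrite (le_trans (exprn_ile1 _ _ _))// lerDl exprn_ge0.
    by rewrite (le_trans (ler_weXn2l (ltW y1) k3))// lerDr.
  apply: (le_trans (cube_le_expR (normr_ge0 y))).
  have [y0|y0] := leP 0 y.
    by rewrite ger0_norm// lerDl mulr_ge0// expR_ge0.
  by rewrite ltr0_norm// lerDr mulr_ge0// expR_ge0.
Qed.

Lemma is_derive_normal_pdf (y : R) : is_derive y 1 p (- y / s ^+ 2 * p y).
Proof.
rewrite normal_pdfE//; apply: is_derive_eq.
rewrite scaler0 add0r !subr0 /GRing.scale/= /normal_fun !subr0 !mulr1.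
by field.
Qed.

(** Since p' = - y p / s^2, the derivative of [F k] is [f k] below, and the vanishing of its
    integral is Stein's identity E Y^(k+1) = s^2 k E Y^(k-1). For k = 0 the truncated predecessor is
    harmless because of the factor k. *)
Let F k (y : R) := - s ^+ 2 * (y ^+ k * p y).

Let f k (y : R) := (y ^+ k.+1 - s ^+ 2 * k%:R * y ^+ k.-1) * p y.

Let is_derive_F k (y : R) : is_derive y 1 (F k) (f k y).
Proof.
have dp := is_derive_normal_pdf y.
have dX : is_derive y 1 (fun z : R => z ^+ k) (k%:R * y ^+ k.-1).
  have -> : (fun z : R => z ^+ k) = id ^+ k by rewrite exprfctE.
  by apply: is_derive_eq; rewrite /GRing.scale/= mulr1.
rewrite /F; apply: is_derive_eq; rewrite /f /GRing.scale/=.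
rewrite (exprS y k); move: (y ^+ k) (y ^+ k.-1) (p y) => a b c.
by field.
Qed.

(** exp u >= u^2 / 2 with u = y^2 / (2 s^2). Decay of order 4 is enough for [F k] to vanish at
    infinity when k <= 2. *)
Let normal_pdf_le (y : R) : y != 0 ->
  p y <= normal_peak s * (8 * s ^+ 4 / y ^+ 4).
Proof.
move=> y0; rewrite normal_pdfE// ler_wpM2l ?normal_peak_ge0// /normal_fun subr0.
have u0 : 0 < y ^+ 2 / (s ^+ 2 *+ 2).
  by rewrite divr_gt0 ?pmulrn_lgt0 ?exprn_even_gt0.
rewrite mulNr expRN -[leRHS]invrK lef_pV2 ?posrE ?expR_gt0//; last first.
  by rewrite invr_gt0 divr_gt0 ?exprn_even_gt0// mulr_gt0// exprn_gt0.
apply: le_trans (expR_ge1Dxn 1 (ltW u0)).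
rewrite -[leLHS]add0r lerD// le_eqVlt; apply/orP; left; apply/eqP.
by rewrite (_ : 2`!%:R = 2 :> R)//; field; rewrite sN0 y0.
Qed.

Let F_le k (y : R) : (k <= 2)%N -> 1 <= `|y| ->
  `|F k y| <= s ^+ 2 * normal_peak s * 8 * s ^+ 4 / `|y|.
Proof.
move=> k2 y1; have y0 : y != 0 by rewrite -normr_gt0 (lt_le_trans _ y1).
rewrite /F mulNr normrN !normrM normrX (ger0_norm (normal_pdf_ge0 _ _ _)).
have -> : `|s| * `|s| = s ^+ 2 by rewrite gtr0_norm.
rewrite [leRHS](_ : _ = s ^+ 2 * (normal_peak s * 8 * s ^+ 4 / `|y|)); last first.
  by rewrite !mulrA.
rewrite ler_wpM2l ?sqr_ge0//.
apply: (@le_trans _ _ (`|y| ^+ 3 * p y)).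
  by rewrite ler_wpM2r ?normal_pdf_ge0// ler_weXn2l// (leq_trans k2).
apply: (le_trans (ler_wpM2l _ (normal_pdf_le y0))); first exact: exprn_ge0.
rewrite -(ger0_norm (_ : 0 <= y ^+ 4)) ?exprn_even_ge0// normrX.
rewrite le_eqVlt; apply/orP; left; apply/eqP; field.
by rewrite normr_eq0.
Qed.

Let cvg_F k (e : R) : (k <= 2)%N -> `|e| = 1 ->
  F k (e * n%:R) @[n --> \oo] --> (0 : R).
Proof.
move=> k2 e1; apply: norm_cvg0.
set C := s ^+ 2 * normal_peak s * 8 * s ^+ 4.
(* The factor 2 turns the bound 1 / n into the shifted harmonic sequence: 1 / n <= 2 / (n + 1) for n
   > 0. *)
apply: (@squeeze_cvgr _ _ _ _ (cst 0) (fun n : nat => C * 2 * n.+1%:R^-1)).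
- near=> n; rewrite normr_ge0/=.
  have n0 : (0 < n)%N by near: n; exact: nbhs_infty_gt.
  have en : `|e * n%:R| = n%:R by rewrite normrM e1 mul1r normr_nat.
  apply: le_trans (F_le k2 _) _; first by rewrite en ler1n.
  rewrite en -/C -mulrA ler_wpM2l//.
    by rewrite /C !mulr_ge0 ?normal_peak_ge0 ?exprn_ge0 ?ltW.
  rewrite ler_pdivlMr ?ltr0n// mulrC ler_pdivrMr ?ltr0n//.
  by rewrite -natrM ler_nat; lia.
- exact: cvg_cst.
- by rewrite -(mulr0 (C * 2)); apply: cvgM; [exact: cvg_cst|exact: cvg_harmonic].
Unshelve. all: by end_near. Qed.

Let integrable_exprn k : (k <= 3)%N ->
  leb.-integrable setT (fun y => (y ^+ k)%:E * (p y)%:E)%E.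
Proof.
move=> k3; have := integrable_normal_exprn k3; apply: integrable_density => //.
- exact: normal_pdf_ge0.
- exact: measurable_normal_pdf.
Qed.

Let integrable_f k : (k <= 2)%N -> leb.-integrable setT (EFin \o f k).
Proof.
move=> k2.
have -> : EFin \o f k = (fun y => (y ^+ k.+1)%:E * (p y)%:E +
   (- (s ^+ 2 * k%:R))%:E * ((y ^+ k.-1)%:E * (p y)%:E))%E.
  by apply/funext => y; rewrite -!EFinM -EFinD /f /=; congr _%:E; ring.
apply: integrableD => //; first exact: integrable_exprn.
apply: integrableZl => //; apply: integrable_exprn.
by rewrite (leq_trans (leq_pred _))// (leq_trans k2).
Qed.

Let integral_f k : (k <= 2)%N -> (\int[leb]_y (f k y)%:E = 0)%E.
Proof.
move=> k2; apply: (@integral_derivative_vanishing _ (F k) (f k)).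
- exact: is_derive_F.
- move=> y; apply: cvgM; last exact: continuous_normal_pdf.
  apply: cvgB; first exact: exprn_continuous.
  by apply: cvgM; [exact: cvg_cst|exact: exprn_continuous].
- exact: integrable_f.
- by under eq_fun => n do rewrite -[n%:R]mul1r; apply: cvg_F; rewrite ?normr1.
- by under eq_fun => n do rewrite -[- n%:R]mulN1r; apply: cvg_F; rewrite ?normrN1.
Qed.

Let moment k : (k <= 2)%N -> (\int[N]_y (y ^+ k.+1)%:E =
  (s ^+ 2 * k%:R)%:E * \int[N]_y (y ^+ k.-1)%:E)%E.
Proof.
move=> k2; have k1 : (k.-1 <= 3)%N.
  by rewrite (leq_trans (leq_pred _))// (leq_trans k2).
rewrite !integral_normal_prob; [|exact: integrable_normal_exprn..].
rewrite -integralZl//; last exact: integrable_exprn.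
have i1 : leb.-integrable setT (fun y => (y ^+ k.+1)%:E * (p y)%:E)%E.
  exact: integrable_exprn.
have i2 : leb.-integrable setT
    (fun y => (s ^+ 2 * k%:R)%:E * ((y ^+ k.-1)%:E * (p y)%:E))%E.
  by apply: integrableZl => //; exact: integrable_exprn.
have fE y : ((f k y)%:E = (y ^+ k.+1)%:E * (p y)%:E -
     (s ^+ 2 * k%:R)%:E * ((y ^+ k.-1)%:E * (p y)%:E))%E.
  by rewrite -!EFinM -EFinB /f; congr _%:E; ring.
have : (\int[leb]_y ((y ^+ k.+1)%:E * (p y)%:E -
     (s ^+ 2 * k%:R)%:E * ((y ^+ k.-1)%:E * (p y)%:E)) = 0)%E.
  by rewrite -(integral_f k2); apply: eq_integral => y _; rewrite fE.
rewrite integralB// -(fineK (integrable_fin_num measurableT i1)).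
rewrite -(fineK (integrable_fin_num measurableT i2)) -EFinB => -[] /eqP.
by rewrite subr_eq0 => /eqP ->.
Qed.

Let moment0 : (\int[N]_y (y ^+ 0)%:E = 1)%E.
Proof.
transitivity (\int[N]_y (cst 1 y))%E; first exact: eq_integral.
by rewrite integral_cst//= mul1e probability_setT.
Qed.

Lemma normal_moment1 : (\int[N]_y y%:E = 0)%E.
Proof. by have := @moment 0 isT; rewrite mulr0 mul0e. Qed.

Lemma normal_moment2 : (\int[N]_y (y ^+ 2)%:E = (s ^+ 2)%:E)%E.
Proof.
have := @moment 1 isT; rewrite mulr1 => ->.
by rewrite moment0 mule1.
Qed.

Lemma normal_moment3 : (\int[N]_y (y ^+ 3)%:E = 0)%E.
Proof.
have := @moment 2 isT => ->.
by rewrite normal_moment1 mule0.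
Qed.

Lemma integral_normal_cubic (a b c e : R) :
  (\int[N]_y (a + b * y + c * y ^+ 2 + e * y ^+ 3)%:E =
   (a + c * s ^+ 2)%:E)%E.
Proof.
have ik k : (k <= 3)%N -> forall r : R,
    N.-integrable setT (fun y => r%:E * (y ^+ k)%:E)%E.
  by move=> k3 r; apply: integrableZl => //; exact: integrable_normal_exprn.
under eq_integral => y _.
  have -> : ((a + b * y + c * y ^+ 2 + e * y ^+ 3)%:E =
    a%:E * (y ^+ 0)%:E + b%:E * (y ^+ 1)%:E
     + c%:E * (y ^+ 2)%:E + e%:E * (y ^+ 3)%:E)%E.
    by rewrite -!EFinM -!EFinD; congr _%:E; ring.
  over.
rewrite !integralD//=; try by repeat (apply: integrableD => //); exact: ik.
rewrite !integralZl//; try exact: integrable_normal_exprn.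
rewrite normal_moment1 normal_moment2 normal_moment3 !mule0.
by rewrite moment0 !mule1 !adde0.
Qed.

End gaussian_moments.

(** * Markov chains driven by independent noise *)

Section independent_pair.
Local Open Scope ereal_scope.
Context d d1 d2 (T : measurableType d) (S : measurableType d1)
  (E : measurableType d2) (R : realType).

Lemma finite_measure_rectangle_unique
    (m m' : {measure set (S * E) -> \bar R}) : m setT < +oo ->
  (forall A B, measurable A -> measurable B -> m (A `*` B) = m' (A `*` B)) ->
  forall X, measurable X -> m X = m' X.
Proof.
move=> moo mm' X mX.
pose C : set (set (S * E)) :=
  [set C | exists A, measurable A /\ exists B, measurable B /\ C = A `*` B].
have CI : setI_closed C.
  move=> /= _ _ [X1 [mX1 [X2 [mX2 ->]]]] [Y1 [mY1 [Y2 [mY2 ->]]]].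
  rewrite -setXI; exists (X1 `&` Y1); split; first exact: measurableI.
  by exists (X2 `&` Y2); split => //; exact: measurableI.
apply: (measure_unique C (fun _ => setT)) => //.
- rewrite measurable_prod_measurableType //; congr (<<s _ >>).
  rewrite predeqE; split => [[A mA [B mB <-]]|[A [mA [B [mB ->]]]]].
    by exists A; split => //; exists B.
  by exists A => //; exists B.
- move=> n; exists setT; split => //; exists setT; split => //.
  by rewrite setXTT.
- by rewrite bigcup_const.
- by move=> A [A1 [mA1 [A2 [mA2 ->]]]]; exact: mm'.
Qed.

Definition pair_mfun (Z : {mfun T >-> S}) (X : {mfun T >-> E}) :
    {mfun T >-> (S * E)%type} :=
  HB.pack (fun w => (Z w, X w)) (isMeasurableFun.Build _ _ _ _ _
    (measurable_fun_pair (measurable_funPT Z) (measurable_funPT X))).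

Variables (P : probability T R) (N : probability E R).
Variables (Z : {mfun T >-> S}) (X : {mfun T >-> E}).

Hypothesis indZX : forall A C, measurable A -> measurable C ->
  P (Z @^-1` A `&` X @^-1` C) = P (Z @^-1` A) * N C.

(** As functions of [D] both sides are finite measures: the law of the pair restricted to [G], and
    the law of the pair scaled by [P G]. They agree on rectangles. *)
Lemma independent_pair_event G : measurable G ->
  (forall A C, measurable A -> measurable C ->
    P (Z @^-1` A `&` X @^-1` C `&` G) = P (Z @^-1` A) * N C * P G) ->
  forall D, measurable D ->
    P (pair_mfun Z X @^-1` D `&` G) = P (pair_mfun Z X @^-1` D) * P G.
Proof.
move=> mG indG D mD.
have PG : P G = (fine (P G))%:E by rewrite fineK// fin_num_measure.
have PG0 : (0 <= fine (P G))%R by rewrite fine_ge0.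
pose m' := mscale (NngNum PG0) (distribution P (pair_mfun Z X)).
have m'E A : m' A = P G * P (pair_mfun Z X @^-1` A) by rewrite [in RHS]PG.
rewrite muleC -m'E.
apply: (@finite_measure_rectangle_unique
  (pushforward (mrestr P mG) (pair_mfun Z X)) m') => //.
  by rewrite /= /pushforward /mrestr preimage_setT setTI ltey_eq fin_num_measure.
move=> A B mA mB; apply: etrans (esym (m'E _)).
by rewrite muleC -[X in _ = X * _]/(P (Z @^-1` A `&` X @^-1` B)) indZX// -indG.
Qed.

Lemma independent_pair_law D : measurable D ->
  distribution P (pair_mfun Z X) D = (distribution P Z \x N) D.
Proof.
apply: finite_measure_rectangle_unique.
  by rewrite ltey_eq fin_num_measure.
move=> A B mA mB; apply: etrans (esym (product_measure1E _ _ mA mB)).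
exact: indZX.
Qed.

Lemma integral_independent_pair (f : S * E -> \bar R) :
  measurable_fun setT f -> P.-integrable setT (f \o pair_mfun Z X) ->
  \int[P]_w f (Z w, X w) = \int[distribution P Z]_z \int[N]_y f (z, y).
Proof.
move=> mf intf.
rewrite -[LHS](integral_distribution (X := pair_mfun Z X))//.
have eqm D : measurable D -> D `<=` setT ->
  distribution P (pair_mfun Z X) D = (distribution P Z \x N) D.
  by move=> mD _; exact: independent_pair_law.
rewrite (eq_measure_integral _ eqm) integral12_prod_meas1//.
apply/integrableP; split => //; rewrite -(eq_measure_integral _ eqm).
rewrite ge0_integral_distribution//; last exact: measurableT_comp.
by case/integrableP : intf.
Qed.

Lemma ge0_integral_independent_pair (f : S * E -> \bar R) :
  measurable_fun setT f -> (forall x, 0 <= f x) ->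
  \int[P]_w f (Z w, X w) = \int[distribution P Z]_z \int[N]_y f (z, y).
Proof.
move=> mf f0.
rewrite -[LHS](ge0_integral_distribution (pair_mfun Z X))//.
rewrite (eq_measure_integral (distribution P Z \x N)); last first.
  by move=> D mD _; exact: independent_pair_law.
by rewrite fubini_tonelli1.
Qed.

End independent_pair.

Section noise_chain.
Local Open Scope ereal_scope.
Context d d1 d2 (T : measurableType d) (S : measurableType d1)
  (E : measurableType d2) (R : realType).
Variables (P : probability T R) (N : probability E R).
Variable xi : nat -> {mfun T >-> E}.
Hypothesis indxi : forall n (C : nat -> set E),
  (forall i, measurable (C i)) ->
  P (\bigcap_(i in `I_n) (xi i @^-1` C i)) = \prod_(i < n) N (C i).
Variables (Phi : {mfun (S * E)%type >-> S}) (z0 : S).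

Fixpoint chain k : {mfun T >-> S} :=
  if k is k'.+1 then
    HB.pack (Phi \o pair_mfun (chain k') (xi k'))
      (isMeasurableFun.Build _ _ _ _ (Phi \o pair_mfun (chain k') (xi k'))
        (measurableT_comp (measurable_funPT Phi)
          (measurable_funPT (pair_mfun (chain k') (xi k')))))
  else cst z0.

(** An event on the noise at times k, ..., n - 1, that is, on the future of [chain k]. *)
Let G k n (C : nat -> set E) :=
  \bigcap_(i in [set i | (k <= i < n)%N]) (xi i @^-1` C i).

Let mG k n C : (forall i, measurable (C i)) -> measurable (G k n C).
Proof.
move=> mC; apply: bigcap_measurableType => i _.
by rewrite -[X in measurable X]setTI; exact: measurable_funPT.
Qed.

Let xiE k C : xi k @^-1` C = G k k.+1 (fun _ => C).
Proof.
apply/seteqP; split => w /=.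
  by move=> Cw i /=; rewrite ltnS -eqn_leq => /eqP <-.
by apply => /=; rewrite leqnn ltnSn.
Qed.

Let PG k n C : (k <= n)%N -> (forall i, measurable (C i)) ->
  P (G k n C) = \prod_(k <= i < n) N (C i).
Proof.
move=> kn mC; pose C' i := if (k <= i)%N then C i else setT.
have mC' i : measurable (C' i) by rewrite /C'; case: ifP.
transitivity (P (\bigcap_(i in `I_n) (xi i @^-1` C' i))).
  congr (P _); rewrite /G; apply/seteqP; split => w /= Gw i /=.
    by move=> ni; rewrite /C'; case: ifP => // ki; apply: Gw; rewrite /= ki.
  by move=> /andP[ki ni]; have := Gw i ni; rewrite /C' ki.
rewrite indxi// -(big_mkord xpredT (fun i => N (C' i))) (big_cat_nat (leq0n k) kn)/=.
rewrite big1_seq ?mul1e.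
  by rewrite big_nat [RHS]big_nat; apply: eq_bigr => i /andP[ki _]; rewrite /C' ki.
move=> i; rewrite mem_index_iota => /andP[_ /andP[_ ik]].
by rewrite /C' leqNgt ik /= probability_setT.
Qed.

(** Independence from the next noise alone would not pass through the induction: [chain k.+1] also
    involves [xi k], which has to be split off from the future noise of [chain k]. *)
Lemma chain_independent_future k n C A : (k <= n)%N ->
  (forall i, measurable (C i)) -> measurable A ->
  P (chain k @^-1` A `&` G k n C) = P (chain k @^-1` A) * P (G k n C).
Proof.
elim: k n C A => [|k ih] n C A kn mC mA.
  have [zA|zA] := pselect (A z0).
    by rewrite /= preimage_cst mem_set// setTI probability_setT mul1e.
  by rewrite /= preimage_cst memNset// set0I measure0 mul0e.
have mPA : measurable (Phi @^-1` A).
  by rewrite -[X in measurable X]setTI; exact: measurable_funPT.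
apply: (@independent_pair_event _ _ _ _ _ _ _ P N (chain k) (xi k) _ _ _ _
  (Phi @^-1` A)) => //.
- move=> A0 C0 mA0 mC0.
  by rewrite xiE ih// PG// big_nat1.
- exact: mG.
- move=> A0 C0 mA0 mC0.
  pose C' i := if i == k then C0 else C i.
  have mC' i : measurable (C' i) by rewrite /C'; case: ifP.
  rewrite -setIA.
  have -> : xi k @^-1` C0 `&` G k.+1 n C = G k n C'.
    apply/seteqP; split => w /=.
      move=> [Cw Gw] i /= /andP[ki ni]; rewrite /C'; case: eqP => [->//|/eqP ik].
      by apply: Gw; rewrite /= ni andbT ltn_neqAle eq_sym ik.
    move=> Gw; split; first by have := Gw k; rewrite /C' eqxx /= leqnn => /(_ kn).
    move=> i /= /andP[ki ni]; have := Gw i; rewrite /= ni (ltnW ki) => /(_ isT).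
    by rewrite /C' gtn_eqF.
  rewrite ih// 1?ltnW// !PG// 1?ltnW// big_ltn// /C' eqxx muleA; congr (_ * _).
  by rewrite big_nat [RHS]big_nat; apply: eq_bigr => i /andP[ki _]; rewrite gtn_eqF.
Qed.

Lemma chain_independent_next k A C : measurable A -> measurable C ->
  P (chain k @^-1` A `&` xi k @^-1` C) = P (chain k @^-1` A) * N C.
Proof.
move=> mA mC.
by rewrite xiE chain_independent_future// PG// big_nat1.
Qed.

Lemma integral_chainS k (f : S -> \bar R) : measurable_fun setT f ->
  P.-integrable setT (f \o chain k.+1) ->
  \int[P]_w f (chain k.+1 w) =
  \int[distribution P (chain k)]_z \int[N]_y f (Phi (z, y)).
Proof.
move=> mf intf.
apply: (integral_independent_pair (chain_independent_next k)
  (f := f \o Phi)) => //; exact: measurableT_comp.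
Qed.

Lemma ge0_integral_chainS k (f : S -> \bar R) : measurable_fun setT f ->
  (forall z, 0 <= f z) ->
  \int[P]_w f (chain k.+1 w) =
  \int[distribution P (chain k)]_z \int[N]_y f (Phi (z, y)).
Proof.
move=> mf f0.
apply: (ge0_integral_independent_pair (chain_independent_next k)
  (f := f \o Phi)) => //; last by move=> z; exact: f0.
exact: measurableT_comp.
Qed.

Lemma chain_martingale k (f : S -> \bar R) : measurable_fun setT f ->
  (forall j, (j <= k)%N -> P.-integrable setT (f \o chain j)) ->
  (forall z, \int[N]_y f (Phi (z, y)) = f z) ->
  \int[P]_w f (chain k w) = f z0.
Proof.
move=> mf + fPhi; elim: k => [|k ih] intf.
  by rewrite [LHS](integral_cst P measurableT (f z0))/= probability_setT mule1.
rewrite integral_chainS//; last exact: intf.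
under eq_integral do rewrite fPhi.
rewrite integral_distribution//; last by apply: intf; rewrite leqnSn.
by apply: ih => j jk; apply: intf; rewrite (leq_trans jk).
Qed.

Lemma chain_supermartingale k (f : S -> \bar R) : measurable_fun setT f ->
  (forall z, 0 <= f z) ->
  (forall z, \int[N]_y f (Phi (z, y)) <= f z) ->
  \int[P]_w f (chain k w) <= f z0.
Proof.
move=> mf f0 fPhi; elim: k => [|k ih].
  by rewrite [leLHS](integral_cst P measurableT (f z0))/= probability_setT mule1.
rewrite ge0_integral_chainS//; apply: le_trans ih.
rewrite -(ge0_integral_distribution (P := P) (chain k))//.
apply: ge0_le_integral => //.
- by move=> z _; exact: integral_ge0.
- apply: (measurable_fun_fubini_tonelli_F (f \o Phi)).
    exact: measurableT_comp.
  by move=> z; exact: f0.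
Qed.

End noise_chain.

(** * Maximal inequality *)

Section increments.
Context (R : realType) (d : measure_display) (T : measurableType d).
Variables (P : probability T R) (B : R -> {RV P >-> R}).
Hypothesis hB : standard_brownian_motion B.

(* [normal_prob] is a measure on [measurableTypeR R], which is not unifiable with
   the canonical measurable structure of [R]; hence this codomain. *)
Definition incr_fun (h : R) (i : nat) : T -> measurableTypeR R :=
  B (i.+1%:R * h) \- B (i%:R * h).

Lemma measurable_incr_fun h i : measurable_fun setT (incr_fun h i).
Proof. by apply: measurable_funB; exact: measurable_funPT. Qed.

Definition incr (h : R) (i : nat) : {mfun T >-> measurableTypeR R} :=
  HB.pack (incr_fun h i)
    (isMeasurableFun.Build _ _ _ _ _ (measurable_incr_fun h i)).

Lemma incr_independent (h : R) n (C : nat -> set R) : 0 < h ->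
  (forall i, measurable (C i)) ->
  P (\bigcap_(i in `I_n) (incr h i @^-1` C i)) =
  (\prod_(i < n) normal_prob 0 (Num.sqrt h) (C i))%E.
Proof.
move=> h0 mC; pose t (i : nat) : R := i%:R * h.
have t0 : 0 <= t 0%N by rewrite /t mul0r.
have ndt : nondecreasing_seq t.
  by move=> i j ij; rewrite /t ler_wpM2r ?ler_nat// ltW.
have := sbm_independent_increments hB t0 ndt (n := n)
  (C := fun i : 'I_n => C i) (fun i => mC i).
rewrite (_ : \bigcap_i _ = \bigcap_(i in `I_n) (incr h i @^-1` C i)).
  move=> ->; apply: eq_bigr => i _.
  have th : t i.+1 - t i = h by rewrite /t -natr1; ring.
  rewrite -[in RHS]th -(sbm_gaussian_increments hB (s := t i) (t := t i.+1)) //.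
  - by rewrite /t mulr_ge0// ltW.
  - by rewrite /t ltr_pM2r// ltr_nat.
apply/seteqP; split => w /= Bw i /=.
  by move=> ni; have := Bw (Ordinal ni) I.
by move=> _; have := Bw i (ltn_ord i).
Qed.

End increments.

Section maximal_inequality.
Context (R : realType) (d : measure_display) (T : measurableType d).
Variables (P : probability T R) (B : R -> {RV P >-> R}).
Hypothesis hB : standard_brownian_motion B.
Variables (mu c : R).
Hypotheses (mu0 : 0 < mu) (c1 : c ^+ 2 = 1).

Definition drift_walk (t : R) (w : T) : R := c * (B t w - B 0 w) - mu / 2 * t.

Lemma measurable_drift_walk t : measurable_fun setT (drift_walk t).
Proof.
apply: measurable_funB => //; apply: measurable_funM => //.
by apply: measurable_funB; exact: measurable_funPT.
Qed.

Lemma measurable_exceed (h a : R) k :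
  measurable [set w | exists2 j, (j <= k)%N & a < drift_walk (j%:R * h) w].
Proof.
rewrite (_ : mkset _ = \bigcup_(j in [set j | (j <= k)%N])
    [set w | a < drift_walk (j%:R * h) w]); last first.
  by apply/seteqP; split => w /= [j jk aj]; exists j.
apply: bigcup_measurable => j _.
rewrite -[X in measurable X]setTI; apply: measurable_fun_ltr => //.
exact: measurable_drift_walk.
Qed.

Section step.
Variables (h a : R).
Hypothesis h0 : 0 < h.

Let step (p : R * measurableTypeR R) : R :=
  if a < p.1 then p.1 else p.1 + c * p.2 - mu / 2 * h.

Let mstep : measurable_fun setT step.
Proof.
apply: measurable_fun_ifT => //.
- exact: measurable_fun_ltr.
- apply: measurable_funB => //; apply: measurable_funD => //.
  exact: measurable_funM.
Qed.

Let stepf : {mfun (R * measurableTypeR R)%type >-> R} :=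
  HB.pack step (isMeasurableFun.Build _ _ _ _ _ mstep).

Let walk := chain (incr B h) stepf 0.

Let walkP k w : a < walk k w \/
  (walk k w = drift_walk (k%:R * h) w /\
   forall j, (j < k)%N -> drift_walk (j%:R * h) w <= a).
Proof.
elim: k => [|k [ih|[ih1 ih2]]].
- by right; split => //; rewrite /drift_walk mul0r subrr !mulr0 subrr.
- by left; rewrite /walk/= /step/= ih.
- rewrite /walk/= /step/= -/(walk k w).
  case: (ltP a (walk k w)) => [|wa]; first by left.
  right; split.
    by rewrite ih1 /drift_walk /incr_fun/= -natr1; ring.
  move=> j; rewrite ltnS leq_eqVlt => /predU1P[->|]; last exact: ih2.
  by rewrite -ih1.
Qed.

(* Since [c ^+ 2 = 1], [expR (mu * drift_walk _)] is a martingale with mean 1; it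
   is stopped when the walk exceeds [a]. *)
Lemma maximal_inequality k :
  (P [set w | exists2 j, (j <= k)%N & (a < drift_walk (j%:R * h) w)%R]
   <= (expR (- mu * a))%:E)%E.
Proof.
pose f (z : R) : \bar R := (expR (mu * z))%:E.
have mf : measurable_fun setT f.
  apply/measurable_EFinP.
  by apply: measurableT_comp => //; exact: measurable_funM.
have f0 z : (0 <= f z)%E by rewrite lee_fin expR_ge0.
have Ef : (\int[P]_w f (walk k w) <= 1)%E.
  have := @chain_supermartingale _ _ _ _ _ _ _ P (normal_prob 0 (Num.sqrt h))
    (incr B h) (fun n C => incr_independent hB n h0) stepf 0 k f mf f0.
  have -> : f 0 = 1%E by rewrite /f mulr0 expR0.
  apply => z.
  have [az|az] := boolP (a < z).
    under eq_integral do rewrite /= /step/= az.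
    by rewrite (integral_cst _ measurableT (f z))/= probability_setT mule1.
  under eq_integral => y _.
    rewrite /= /step/= (negbTE az).
    rewrite (_ : f _ = (expR (mu * z - mu ^+ 2 * h / 2))%:E *
      (expR (mu * c * y))%:E)%E; last first.
      by rewrite -EFinM -expRD /f; congr ((expR _)%:E); field.
    over.
  rewrite ge0_integralZl//=; last first.
    by apply/measurable_EFinP; apply: measurableT_comp => //; exact: measurable_funM.
  rewrite normal_mgf ?sqrtr_gt0// -EFinM -expRD lee_fin ler_expR (sqr_sqrtr (ltW h0)).
  by rewrite exprMn c1 mulr1; lra.
have mwa : measurable [set w | a < walk k w].
  by rewrite -[X in measurable X]setTI; apply: measurable_fun_ltr.
apply: (@le_trans _ _ (P [set w | a < walk k w])).
  apply: le_measure; rewrite ?inE//.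
    exact: measurable_exceed.
  move=> w /= [j jk aj]; case: (walkP k w) => [//|[-> H]].
  move: jk; rewrite leq_eqVlt => /predU1P[<-//|/H].
  by rewrite leNgt aj.
(* Markov's inequality for [expR (mu * walk k w)] at the level [expR (mu * a)]. *)
rewrite -(@lee_pmul2l _ (expR (mu * a))%:E) ?lte_fin ?expR_gt0//.
rewrite -EFinM -expRD mulNr subrr expR0.
apply: le_trans Ef.
rewrite -integral_cst// integral_mkcond; apply: ge0_le_integral => //.
- by move=> w _; rewrite patchE; case: ifP => _; rewrite // lee_fin expR_ge0.
- by apply/(measurable_restrictT _ _).1 => //; exact: measurable_cst.
- by apply: measurableT_comp => //; exact: measurable_funPT.
- move=> w _; rewrite patchE; case: ifPn => [|_]; last exact: f0.
  by rewrite inE/= => aw; rewrite lee_fin ler_expR ler_pM2l// ltW.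
Qed.

End step.

(* The horizon of the [n]-th grid is [2 ^ n], so the events increase with [n] and
   exhaust all dyadic times. *)
Definition exceed (a : R) : set T :=
  \bigcup_n [set w | exists2 j, (j <= 4 ^ n)%N &
    a < drift_walk (j%:R * 2 ^- n) w].

Lemma measurable_exceedT a : measurable (exceed a).
Proof. by apply: bigcupT_measurable => n; exact: measurable_exceed. Qed.

Lemma exceed_le a : (P (exceed a) <= (expR (- mu * a))%:E)%E.
Proof.
set E := fun n => [set w | exists2 j, (j <= 4 ^ n)%N &
    a < drift_walk (j%:R * 2 ^- n) w].
have cvE : P (E n) @[n --> \oo] --> P (exceed a).
  apply: nondecreasing_cvg_mu.
  - by move=> n; exact: measurable_exceed.
  - exact: measurable_exceedT.
  - apply/nondecreasing_seqP => n; apply/subsetPset => w [j jn aj].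
    exists (j * 2)%N; first by rewrite (leq_trans (leq_mul jn (leqnn 2)))// expnS mulnC leq_mul2r orbT.
    rewrite (_ : (j * 2)%:R * 2 ^- n.+1 = j%:R * 2 ^- n)//.
    by rewrite natrM exprS; field; rewrite expf_neq0.
rewrite -(cvg_lim _ cvE)//; apply: lime_le; first by apply/cvg_ex; eexists; exact: cvE.
by apply: nearW => n; apply: maximal_inequality; rewrite invr_gt0 exprn_gt0.
Qed.

End maximal_inequality.

(** * An integrable bound for the Brownian path *)

Section domination.
Context (R : realType) (d : measure_display) (T : measurableType d).
Variables (P : probability T R) (B : R -> {RV P >-> R}).
Hypothesis hB : standard_brownian_motion B.
Variable mu : R.
Hypothesis mu0 : 0 < mu.

Let A (m : nat) := exceed B mu 1 m%:R `|` exceed B mu (-1) m%:R.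

(** Half of the exponential rate in [PA]: weighting [A m] by r^m still leaves a convergent geometric
    series, of ratio 1 / r, so that [D] is integrable although it grows exponentially in the
    exceeded level. *)
Let r := expR (mu / 2).

Let mA m : measurable (A m).
Proof. by apply: measurableU; exact: measurable_exceedT. Qed.

Let PA m : (P (A m) <= (2 * expR (- mu * m%:R))%:E)%E.
Proof.
rewrite /A; apply: le_trans (measureU2 _ _ _) _; [exact: measurable_exceedT..|].
rewrite mulr2n mulrDl mul1r EFinD leeD//; apply: exceed_le => //.
  by rewrite expr1n.
by rewrite sqrrN expr1n.
Qed.

Let D (w : T) : \bar R := (\sum_(0 <= m <oo) (r ^+ m)%:E * (\1_(A m) w)%:E)%E.

Let r1 : 1 < r. Proof. by rewrite /r expR_gt1 divr_gt0. Qed.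

Let D_lty : (\int[P]_w D w < +oo)%E.
Proof.
rewrite /D integral_nneseries//; last 2 first.
- move=> m; apply: emeasurable_funM => //.
  by apply/measurable_EFinP; exact: measurable_indic.
- by move=> m w _; rewrite mule_ge0// lee_fin ?exprn_ge0 ?expR_ge0.
apply: (@le_lt_trans _ _ (\sum_(0 <= m <oo) (2 * (r^-1) ^+ m)%:E)%E).
  apply: lee_nneseries => m _.
    by move=> _; apply: integral_ge0 => w _; rewrite mule_ge0// lee_fin ?exprn_ge0 ?expR_ge0.
  rewrite ge0_integralZl//; last 2 first.
    by apply/measurable_EFinP; exact: measurable_indic.
    by rewrite lee_fin exprn_ge0 ?expR_ge0.
  rewrite integral_indic// setIT.
  apply: le_trans (lee_wpmul2l _ (PA m)) _; first by rewrite lee_fin exprn_ge0 ?expR_ge0.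
  rewrite -EFinM lee_fin /r -expRN -!expRM_natl mulrCA -expRD.
  by rewrite ler_wpM2l// ler_expR; lra.
have q0 : 0 <= r^-1 by rewrite invr_ge0 expR_ge0.
have q1 : r^-1 < 1 by rewrite invf_lt1// (lt_trans _ r1).
apply: (@le_lt_trans _ _ (2 / (1 - r^-1))%:E); last exact: ltry.
apply: lime_le.
  by apply: is_cvg_nneseries => n _ _; rewrite lee_fin mulr_ge0// exprn_ge0.
apply: nearW => n; rewrite sumEFin lee_fin -mulr_sumr ler_wpM2l//.
rewrite -[leRHS]mul1r ler_pdivlMr ?subr_gt0// big_mkord mulrC.
by rewrite -opprB mulNr -subrX1 opprB lerBlDr lerDl exprn_ge0.
Qed.

Let D0 w m : (0 <= (r ^+ m)%:E * (\1_(A m) w)%:E)%E.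
Proof. by rewrite mule_ge0// lee_fin ?exprn_ge0 ?expR_ge0. Qed.

Let D_ge0 w : (0 <= D w)%E.
Proof. by apply: nneseries_ge0 => m _ _; exact: D0. Qed.

Let D_ge m w : A m w -> ((r ^+ m)%:E <= D w)%E.
Proof.
move=> Amw; rewrite /D (nneseriesD1 (n := m))//.
rewrite indicE mem_set// mule1 leeDl//.
by apply: nneseries_ge0 => k _ _; exact: D0.
Qed.

Let D_integrable : P.-integrable setT D.
Proof.
apply/integrableP; split.
  apply: ge0_emeasurable_sum => // m _; apply: emeasurable_funM => //.
  by apply/measurable_EFinP; exact: measurable_indic.
under eq_integral => w _ do rewrite gee0_abs ?D_ge0//.
exact: D_lty.
Qed.

Let notA m w : ~ A m w -> forall n j, (j <= 4 ^ n)%N ->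
  `|B (j%:R * 2 ^- n) w - B 0 w| <= m%:R + mu / 2 * (j%:R * 2 ^- n).
Proof.
move=> nA n j jn; set t := _ * _; rewrite ler_norml; apply/andP; split.
  rewrite lerNl leNgt; apply/negP => mt; apply: nA; right; exists n => //.
  by exists j => //; rewrite /drift_walk -/t mulN1r ltrBrDr.
rewrite leNgt; apply/negP => mt; apply: nA; left; exists n => //.
by exists j => //; rewrite /drift_walk -/t mul1r ltrBrDr.
Qed.

(** r^m is the cube of exp (mu m / 6) >= 1 + mu m / 6, and multiplying the latter by 1 + 6 / mu
    gives at least 1 + m. *)
Let natr_cube_le m : (m.+1)%:R ^+ 3 <= (1 + 6 / mu) ^+ 3 * r ^+ m.
Proof.
rewrite /r -expRM_natr (_ : mu / 2 * m%:R = 3%:R * (mu * m%:R / 6)); last by field.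
have k0 : 0 <= 1 + 6 / mu by rewrite addr_ge0// divr_ge0// ltW.
rewrite expRM_natl -exprMn; apply: lerXn2r.
- by rewrite nnegrE.
- by rewrite nnegrE mulr_ge0// expR_ge0.
apply: (@le_trans _ _ ((1 + 6 / mu) * (1 + mu * m%:R / 6))); last first.
  by rewrite ler_wpM2l// expR_ge1Dx.
rewrite (_ : (1 + 6 / mu) * (1 + mu * m%:R / 6) =
  1 + m%:R + 6 / mu + mu * m%:R / 6); last first.
  by field; rewrite gt_eqF.
rewrite -natr1 addrC -addrA lerDl addr_ge0 ?divr_ge0 ?mulr_ge0//; exact: ltW.
Qed.

(** [m] is the least level that is not exceeded; if every level is exceeded, [D] is infinite. The
    cube is the growth of [mart] in m: position and time are linear in m, the area is quadratic. *)
Lemma exists_dominating : exists2 G : T -> \bar R, P.-integrable setT G &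
  forall w, G w = +oo%E \/ exists m : nat, (((m.+1)%:R ^+ 3)%:E <= G w)%E /\
    forall n j, (j <= 4 ^ n)%N ->
      `|B (j%:R * 2 ^- n) w - B 0 w| <= m%:R + mu / 2 * (j%:R * 2 ^- n).
Proof.
(* Minimality of the level m only gives D >= r^(m-1); the last factor [r] recovers the missing
   power. *)
pose K := (1 + 6 / mu) ^+ 3 * r.
have K1 : 1 <= K.
  apply: le_trans (ltW r1) _; rewrite /K ler_peMl ?expR_ge0//.
  by rewrite exprn_ege1// lerDl divr_ge0// ltW.
have K0 : 0 < K by rewrite (lt_le_trans _ K1).
exists (fun w => K%:E * (cst 1 w + D w))%E.
  apply: integrableZl => //; apply: integrableD => //.
  exact: finite_measure_integrable_cst.
move=> w; have [[m nAm]|allA] := pselect (exists m, ~ A m w); last first.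
  left; suff -> : D w = +oo%E by rewrite addey// gt0_muley// lte_fin.
  apply/eqyP => a a0; have [m am] : exists m : nat, a <= mu / 2 * m%:R.
    exists (Num.bound (a / (mu / 2))).
    rewrite mulrC -ler_pdivrMr ?divr_gt0//.
    by rewrite ltW// archi_boundP// divr_ge0// ?ltW// divr_gt0.
  have /D_ge : A m w by apply: contrapT => nA; apply: allA; exists m.
  apply: le_trans; rewrite lee_fin /r -expRM_natr (le_trans am)//.
  by rewrite (le_trans _ (expR_ge1Dx _))// lerDr.
right.
have exm : exists m, `[< ~ A m w >] by exists m; apply/asboolP.
case: (ex_minnP exm) => {nAm}m /asboolP nAm mmin.
exists m; split; last exact: notA.
case: m => [|m] in nAm mmin *.
  rewrite expr1n; apply: (@le_trans _ _ (K%:E * 1)%E); first by rewrite mule1 lee_fin.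
  by rewrite lee_pmul2l// leeDl.
have /D_ge Dm : A m w.
  by apply: contrapT => /asboolP/mmin; rewrite ltnn.
apply: (@le_trans _ _ (K%:E * (r ^+ m)%:E)%E).
  by rewrite -EFinM lee_fin /K -mulrA -exprS natr_cube_le.
by rewrite lee_pmul2l// (le_trans Dm)// leeDr.
Qed.

End domination.

(** * The stopped random walk *)

Section discrete_martingale.
Context (R : realType).
Variables (mu h : R).
Hypotheses (mu0 : 0 < mu) (h0 : 0 < h).

(* The state is (position, Riemann sum of the positions, time), frozen as soon as
   the position is negative. *)
Definition stopped_step (p : R * R * R * measurableTypeR R) : R * R * R :=
  let: (y, s, t) := p.1 in
  if 0 <= y then (y - mu * h + p.2, s + h * y, t + h) else (y, s, t).

Lemma measurable_stopped_step : measurable_fun setT stopped_step.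
Proof.
have m1 : measurable_fun setT (fun p : R * R * R * measurableTypeR R => p.1.1.1).
  by do 2 apply: measurableT_comp => //.
have m2 : measurable_fun setT (fun p : R * R * R * measurableTypeR R => p.1.1.2).
  by do 2 apply: measurableT_comp => //.
have m3 : measurable_fun setT (fun p : R * R * R * measurableTypeR R => p.1.2).
  by apply: measurableT_comp.
have -> : stopped_step = fun p => if 0 <= p.1.1.1 then
    (p.1.1.1 - mu * h + p.2, p.1.1.2 + h * p.1.1.1, p.1.2 + h)
    else (p.1.1.1, p.1.1.2, p.1.2).
  by apply/funext => -[[[y s] t] u].
apply: measurable_fun_ifT => //=.
- exact: measurable_fun_ler.
- apply: measurable_fun_pair => /=; last exact: measurable_funD.
  apply: measurable_fun_pair => /=.
    by apply: measurable_funD => //; exact: measurable_funB.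
  by apply: measurable_funD => //; exact: measurable_funM.
- apply: measurable_fun_pair => //=.
  exact: measurable_fun_pair.
Qed.

Definition stopped_kernel : {mfun (R * R * R * measurableTypeR R)%type >-> (R * R * R)%type} :=
  HB.pack stopped_step (isMeasurableFun.Build _ _ _ _ _ measurable_stopped_step).

(* If tau' and A' are the passage time and Riemann area of the walk of step [h]
   started at [y], and overshoot is ignored, this is the conditional expectation
   of [(t + tau') * (s + A')]. Its coefficients solve the discrete Poisson
   equations exactly, so that it is a martingale for every [h > 0], not only in
   the limit. *)
Definition mart (z : R * R * R) : R :=
  let: (y, s, t) := z in
  t * s + t * (y ^+ 2 / (2 * mu) + (1 / (2 * mu ^+ 2) + h / 2) * y)
  + s * y / mu + y ^+ 3 / (2 * mu ^+ 2)
  + (1 / mu ^+ 3 + h / (2 * mu)) * y ^+ 2 + y / mu ^+ 4.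

Lemma measurable_mart : measurable_fun setT mart.
Proof.
have m1 : measurable_fun setT (fun p : R * R * R => p.1.1).
  by apply: measurableT_comp.
have m2 : measurable_fun setT (fun p : R * R * R => p.1.2).
  by apply: measurableT_comp.
have m3 : measurable_fun setT (fun p : R * R * R => p.2) by exact: measurable_snd.
rewrite (_ : mart = fun p : R * R * R => p.2 * p.1.2 + p.2 * (p.1.1 ^+ 2 * (2 * mu)^-1 + (1 / (2 * mu ^+ 2) + h / 2) * p.1.1)
  + p.1.2 * p.1.1 * mu^-1 + p.1.1 ^+ 3 * (2 * mu ^+ 2)^-1
  + (1 / mu ^+ 3 + h / (2 * mu)) * p.1.1 ^+ 2 + p.1.1 * (mu ^+ 4)^-1); last first.
  by apply/funext => -[[y s] t].
by repeat first [apply: measurable_funD => // | apply: measurable_funM => // | apply: measurable_funX => //].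
Qed.

Lemma integral_mart_step z :
  (\int[normal_prob 0 (Num.sqrt h)]_u (mart (stopped_step (z, u)))%:E =
   (mart z)%:E)%E.
Proof.
case: z => [[y s] t]; rewrite /stopped_step /=.
have [y0|y0] := leP 0 y; last first.
  by rewrite (integral_cst _ measurableT (mart (y, s, t))%:E)/= probability_setT mule1.
pose v := y - mu * h; pose t' := t + h; pose s' := s + h * y.
pose b := 1 / (2 * mu ^+ 2) + h / 2.
pose c2 := 1 / mu ^+ 3 + h / (2 * mu).
(* Taylor expansion in the Gaussian increment [u]: [mart] is a cubic in it, of which the mean
   retains the constant term and h times the coefficient of u^2. *)
under eq_integral => u _.
  rewrite (_ : mart _ = mart (v, s', t')
    + (t' * (v / mu + b) + s' / mu + 3 * v ^+ 2 / (2 * mu ^+ 2) + 2 * c2 * v + 1 / mu ^+ 4) * u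
    + (t' / (2 * mu) + 3 * v / (2 * mu ^+ 2) + c2) * u ^+ 2
    + (1 / (2 * mu ^+ 2)) * u ^+ 3); last first.
    by rewrite /mart -/v -/t' -/s' /c2 /b; field; rewrite gt_eqF.
  over.
rewrite integral_normal_cubic ?sqrtr_gt0// (sqr_sqrtr (ltW h0)).
congr _%:E; rewrite /mart /v /t' /s' /b /c2; field.
by rewrite gt_eqF.
Qed.

End discrete_martingale.

Section mart_bound.
Context (R : realType).
Variable (mu : R).
Hypotheses (mu0 : 0 < mu).

(** Give [y] and [t] weight 1 and [s] weight 2: every monomial of [mart] has weight at most 3. The
    constants [b] and [c2] are the coefficients that depend on h, taken at h = 1. *)
Lemma mart_le (q : R) : 0 < q -> exists2 C : R, 0 < C &
  forall h V y s t, 0 <= h <= 1 -> 1 <= V ->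
    `|y| <= q * V -> `|s| <= q * V ^+ 2 -> `|t| <= q * V ->
    `|mart mu h (y, s, t)| <= C * V ^+ 3.
Proof.
move=> q0; pose b := 1 / (2 * mu ^+ 2) + 1 / 2.
pose c2 := 1 / mu ^+ 3 + 1 / (2 * mu).
have b0 : 0 < b by rewrite addr_gt0// divr_gt0// ?mulr_gt0// exprn_gt0.
have c20 : 0 < c2 by rewrite addr_gt0// divr_gt0// ?mulr_gt0// exprn_gt0.
pose C := q ^+ 2 + q * (q ^+ 2 / (2 * mu) + b * q) + q ^+ 2 / mu
  + q ^+ 3 / (2 * mu ^+ 2) + c2 * q ^+ 2 + q / mu ^+ 4.
have mu1 : 0 < mu^-1 by rewrite invr_gt0.
exists C.
  by rewrite /C !addr_gt0 ?divr_gt0 ?mulr_gt0 ?addr_gt0 ?divr_gt0 ?mulr_gt0 ?exprn_gt0.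
move=> h V y s t /andP[h0 h1] V1 yV sV tV.
have V0 : 0 < V by rewrite (lt_le_trans _ V1).
have qV0 : 0 <= q * V by rewrite mulr_ge0// ltW.
have V13 : V <= V ^+ 3 by rewrite ler_eXnr.
have V23 : V ^+ 2 <= V ^+ 3 by rewrite ler_weXn2l.
have y2 : `|y| ^+ 2 <= q ^+ 2 * V ^+ 2.
  by rewrite -exprMn lerXn2r ?nnegrE.
have y3 : `|y| ^+ 3 <= q ^+ 3 * V ^+ 3.
  by rewrite -exprMn lerXn2r ?nnegrE.
have bh : `|1 / (2 * mu ^+ 2) + h / 2| <= b.
  rewrite ger0_norm ?addr_ge0 ?divr_ge0 ?mulr_ge0 ?exprn_ge0 ?(ltW mu0)//.
  by rewrite lerD2l ler_pM2r ?invr_gt0.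
have ch : `|1 / mu ^+ 3 + h / (2 * mu)| <= c2.
  rewrite ger0_norm ?addr_ge0 ?divr_ge0 ?mulr_ge0 ?exprn_ge0 ?(ltW mu0)//.
  by rewrite lerD2l ler_pM2r ?invr_gt0 ?mulr_gt0.
rewrite /mart; set b' := _ + h / 2 in bh *; set c' := _ + h / (2 * mu) in ch *.
have nd (p : R) : 0 < p -> `|p^-1| = p^-1.
  by move=> p0; rewrite gtr0_norm// invr_gt0.
have T1 : `|t * s| <= q ^+ 2 * V ^+ 3.
  rewrite normrM (_ : q ^+ 2 * V ^+ 3 = q * V * (q * V ^+ 2)); last by ring.
  exact: ler_pM.
have T2 : `|t * (y ^+ 2 / (2 * mu) + b' * y)| <=
    q * (q ^+ 2 / (2 * mu) + b * q) * V ^+ 3.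
  rewrite normrM; apply: (@le_trans _ _ (q * V * ((q ^+ 2 / (2 * mu) + b * q) * V ^+ 2))).
    apply: ler_pM => //; apply: (le_trans (ler_normD _ _)).
    rewrite [leRHS]mulrDl; apply: lerD.
      by rewrite normrM nd ?mulr_gt0// normrX [leRHS]mulrAC ler_pM2r// invr_gt0 mulr_gt0//.
    rewrite normrM (le_trans (ler_pM _ _ bh yV))// mulrA.
    by rewrite ler_pM2l ?mulr_gt0// ler_eXnr.
  by rewrite le_eqVlt; apply/orP; left; apply/eqP; ring.
have T3 : `|s * y / mu| <= q ^+ 2 / mu * V ^+ 3.
  rewrite !normrM nd// [leRHS]mulrAC ler_pM2r//.
  rewrite (_ : q ^+ 2 * V ^+ 3 = (q * V ^+ 2) * (q * V)); last by ring.
  exact: ler_pM.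
have T4 : `|y ^+ 3 / (2 * mu ^+ 2)| <= q ^+ 3 / (2 * mu ^+ 2) * V ^+ 3.
  by rewrite normrM nd ?mulr_gt0 ?exprn_gt0// normrX [leRHS]mulrAC ler_pM2r// invr_gt0 mulr_gt0 ?exprn_gt0.
have T5 : `|c' * y ^+ 2| <= c2 * q ^+ 2 * V ^+ 3.
  rewrite normrM normrX -mulrA ler_pM ?exprn_ge0// (le_trans y2)//.
  by rewrite ler_pM2l ?exprn_gt0.
have T6 : `|y / mu ^+ 4| <= q / mu ^+ 4 * V ^+ 3.
  rewrite normrM nd ?exprn_gt0// [leRHS]mulrAC ler_pM2r ?invr_gt0 ?exprn_gt0//.
  by rewrite (le_trans yV)// ler_pM2l.
rewrite (_ : C * V ^+ 3 = q ^+ 2 * V ^+ 3 +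
  q * (q ^+ 2 / (2 * mu) + b * q) * V ^+ 3 + q ^+ 2 / mu * V ^+ 3 +
  q ^+ 3 / (2 * mu ^+ 2) * V ^+ 3 + c2 * q ^+ 2 * V ^+ 3 +
  q / mu ^+ 4 * V ^+ 3); last by rewrite /C; ring.
by do 5 (apply: (le_trans (ler_normD _ _)); apply: lerD => //).
Qed.

End mart_bound.

Section stopped_brownian.
Context (R : realType) (d : measure_display) (T : measurableType d).
Variables (P : probability T R) (B : R -> {RV P >-> R}).
Hypothesis hB : standard_brownian_motion B.
Variables (x mu : R).
Hypotheses (x0 : 0 < x) (mu0 : 0 < mu).

(** Subtracting [B 0 w], which is 0 only almost surely, makes every path start exactly at [x] and
    depend on increments alone. *)
Definition bpath (w : T) (t : R) : R := x - mu * t + (B t w - B 0 w).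

Definition stopped (h : R) (k : nat) : {mfun T >-> (R * R * R)%type} :=
  chain (incr B h) (stopped_kernel mu h) (x, 0, 0) k.

(** [j] is the minimum of k and the first grid index with a negative position. *)
Lemma stoppedP h k w : exists j : nat, [/\ (j <= k)%N,
  stopped h k w = (bpath w (j%:R * h), h * \sum_(i < j) bpath w (i%:R * h), j%:R * h),
  forall i, (i < j)%N -> 0 <= bpath w (i%:R * h) &
  (j < k)%N -> bpath w (j%:R * h) < 0].
Proof.
elim: k => [|k [j [jk zE pos neg]]].
  exists 0%N; split => //.
  by rewrite /stopped/= /bpath mul0r mulr0 subrr subr0 addr0 big_ord0 mulr0.
rewrite /stopped/= -/(stopped h k) /stopped_step/= zE.
case: ifPn => py.
  have jE : j = k.
    apply/eqP; rewrite eqn_leq jk leqNgt; apply/negP => /neg.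
    by rewrite ltNge py.
  subst k; exists j.+1; split => //.
  - congr (_, _, _); rewrite ?big_ord_recr/= ?mulrDr//.
      by rewrite /bpath /incr_fun/= -natr1; ring.
    by rewrite -natr1; ring.
  - by move=> i; rewrite ltnS leq_eqVlt => /predU1P[->|/pos].
  - by rewrite ltnn.
exists j; split => //; first exact: leqW.
by rewrite ltNge py.
Qed.

(** The noise uses at most half of the drift, so the position at time t is at most x + m - mu t / 2.
    As it is nonnegative before stopping, the stopping time is linear in m; then so is the final
    position, and the area is at most time times x + m. *)
Lemma stopped_bound : exists2 q : R, 0 < q & forall n k m w,
  (k <= 4 ^ n)%N ->
  (forall j, (j <= 4 ^ n)%N ->
      `|B (j%:R * 2 ^- n) w - B 0 w| <= m%:R + mu / 2 * (j%:R * 2 ^- n)) ->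
  let: (y, s, t) := stopped (2 ^- n) k w in
  [/\ `|y| <= q * m.+1%:R, `|s| <= q * m.+1%:R ^+ 2 & `|t| <= q * m.+1%:R].
Proof.
(* The last nonnegative position occurs at a time at most 2 (x + m) / mu; the final [+ 1] pays for
   one more step, of length h <= 1. *)
pose C1 := 2 * (x + 1) / mu + 1.
have x10 : 0 < x + 1 by rewrite addr_gt0.
have C10 : 0 < C1 by rewrite /C1 addr_gt0// divr_gt0// mulr_gt0.
pose q := C1 + C1 * (x + 1) + ((x + 1) + 3 / 2 * mu * C1).
have qa : 0 < C1 * (x + 1) by rewrite mulr_gt0.
have qb : 0 < 3 / 2 * mu * C1 by rewrite !mulr_gt0.
exists q; first by rewrite /q; lra.
move=> n k m w k4; set h := 2 ^- n => Bm.
have h0 : 0 < h by rewrite invr_gt0 exprn_gt0.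
have h1 : h <= 1 by rewrite invf_le1 ?exprn_gt0// exprn_ege1// ler1n.
have [j [jk -> pos neg]] := stoppedP h k w.
have j4 : (j <= 4 ^ n)%N by exact: leq_trans k4.
set V : R := m.+1%:R; have VE : V = m%:R + 1 by rewrite /V -natr1.
have m0 : 0 <= m%:R :> R by [].
have V1 : 1 <= V by rewrite VE lerDr.
have V0 : 0 < V by rewrite (lt_le_trans _ V1).
have xmV : x + m%:R <= (x + 1) * V.
  by rewrite VE; have := mulr_ge0 (ltW x0) m0; lra.
have path_le i : (i <= 4 ^ n)%N ->
    bpath w (i%:R * h) <= x + m%:R - mu / 2 * (i%:R * h).
  move=> i4; have := ler_normlW (Bm i i4); rewrite -/h /bpath.
  by set t := _ * h => ?; lra.
have tV : j%:R * h <= C1 * V.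
  case: j jk pos neg j4 => [|j] jk pos _ j4.
    by rewrite mul0r mulr_ge0// ltW.
  have := le_trans (pos j (ltnSn j)) (path_le j (ltnW j4)).
  rewrite (_ : j.+1%:R * h = j%:R * h + h); last by rewrite -natr1; ring.
  set t := j%:R * h => xt.
  have : t <= 2 * ((x + 1) * V) / mu.
    by rewrite ler_pdivlMr//; lra.
  rewrite (_ : 2 * ((x + 1) * V) / mu = 2 * (x + 1) / mu * V); last by ring.
  move=> tx; rewrite /C1 [leRHS]mulrDl mul1r.
  by apply: lerD => //; exact: le_trans V1.
have t0 : 0 <= j%:R * h by rewrite mulr_ge0// ltW.
have yV : `|bpath w (j%:R * h)| <= (x + 1) * V + 3 / 2 * mu * (C1 * V).
  have := Bm j j4; rewrite -/h /bpath; set t := j%:R * h in tV t0 *.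
  set b := B t w - B 0 w => bm.
  have mt : mu * t <= mu * (C1 * V) by rewrite ler_pM2l.
  have mt0 : 0 <= mu * t by rewrite mulr_ge0// ltW.
  have := ler_normD (x - mu * t) b; have := ler_normB x (mu * t).
  by rewrite (gtr0_norm x0) (ger0_norm mt0); lra.
have sV : `|h * \sum_(i < j) bpath w (i%:R * h)| <= C1 * (x + 1) * V ^+ 2.
  rewrite ger0_norm; last first.
    by rewrite mulr_ge0 ?(ltW h0)// sumr_ge0// => i _; exact: pos.
  apply: (@le_trans _ _ (h * (j%:R * ((x + 1) * V)))); last first.
    rewrite (_ : h * _ = j%:R * h * ((x + 1) * V)); last by ring.
    rewrite (_ : C1 * (x + 1) * V ^+ 2 = C1 * V * ((x + 1) * V)); last by ring.
    by rewrite ler_wpM2r// mulr_ge0// ltW.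
  rewrite ler_pM2l// -[X in X%:R * _](card_ord j) -sum1_card natr_sum mulr_suml.
  rewrite ler_sum// => i _; rewrite mul1r.
  apply: le_trans (path_le i _) _.
    by rewrite (leq_trans (ltnW (ltn_ord i))).
  by apply: le_trans xmV; rewrite gerBl !mulr_ge0// ltW.
have V12 : V <= V ^+ 2 by rewrite ler_eXnr.
split.
- apply: (le_trans yV); rewrite /q; nra.
- apply: (le_trans sV); rewrite ler_wpM2r ?exprn_ge0 ?(ltW V0)// /q; lra.
- rewrite (ger0_norm t0) (le_trans tV)// ler_wpM2r ?(ltW V0)// /q; lra.
Qed.

Lemma mart_dominated : exists2 G : T -> \bar R, P.-integrable setT G &
  forall n k w, (k <= 4 ^ n)%N ->
    (`|(mart mu (2 ^- n) (stopped (2 ^- n) k w))%:E| <= G w)%E.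
Proof.
have [q q0 qP] := stopped_bound.
have [C C0 CP] := mart_le mu0 q0.
have [G iG GP] := exists_dominating hB mu0.
exists (fun w => C%:E * G w)%E; first exact: integrableZl.
move=> n k w k4; case: (GP w) => [->|[m [mG Bm]]].
  by rewrite gt0_muley ?lte_fin// leey.
have := qP n k m w k4 (Bm n); case: (stopped _ _ _) => [[y s] t] [yV sV tV].
apply: (@le_trans _ _ (C%:E * (m.+1%:R ^+ 3)%:E)%E); last first.
  by rewrite lee_pmul2l// lte_fin.
rewrite -EFinM abse_EFin lee_fin; apply: CP => //.
  rewrite invr_ge0 exprn_ge0//= invf_le1 ?exprn_gt0// exprn_ege1// ler1n//.
by rewrite ler1n.
Qed.

Lemma measurable_mart_stopped h k :
  measurable_fun setT (fun w => (mart mu h (stopped h k w))%:E).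
Proof.
apply/measurable_EFinP; apply: measurableT_comp; last exact: measurable_funPT.
exact: measurable_mart.
Qed.

Lemma integral_mart_stopped n k : (k <= 4 ^ n)%N ->
  (\int[P]_w (mart mu (2 ^- n) (stopped (2 ^- n) k w))%:E =
   (mart mu (2 ^- n) (x, 0, 0))%:E)%E.
Proof.
move=> k4; set h := 2 ^- n.
have h0 : 0 < h by rewrite invr_gt0 exprn_gt0.
have [G iG GP] := mart_dominated.
apply: (@chain_martingale _ _ _ _ _ _ _ P (normal_prob 0 (Num.sqrt h)) (incr B h)
  (fun m C => incr_independent hB m h0) (stopped_kernel mu h) (x, 0, 0) k
  (fun z => (mart mu h z)%:E)).
- by apply/measurable_EFinP; exact: measurable_mart.
- move=> j jk; apply: le_integrable iG => //; first exact: measurable_mart_stopped.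
  move=> w _; apply: (le_trans (GP n j w _)); first exact: leq_trans k4.
  exact: lee_abs.
- by move=> z; exact: integral_mart_step.
Qed.

End stopped_brownian.

(** * First entry of a continuous path *)

Section uniform_continuity.
Context (R : realType).

(** Only [x] is confined to the segment; [t] may leave it, as the last cell of a Riemann sum
    does. *)
Lemma continuous_segment_unif (f : R -> R) (a b : R) : continuous f ->
  forall e : R, 0 < e -> exists2 dl : R, 0 < dl &
    forall x t : R, x \in `[a, b] -> `|t - x| < dl -> `|f t - f x| < e.
Proof.
move=> cf e e0.
have /compact_near_coveringP/(_ _ (0 : R)^'+ (fun dl x =>
  forall t, `|t - x| < dl -> `|f t - f x| < e)) := @segment_compact R a b.
case=> [x _|dl /= dl0 dlP].
  have e20 : 0 < e / 2 by rewrite divr_gt0.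
  have /cvgrPdist_lt/(_ _ e20)/nbhs_ballP[r /= r0 rP] := cf x.
  near=> y dl => t /= tdl.
  have yr : `|x - y| < r / 2.
    by near: y; apply: nbhsx_ballx; rewrite divr_gt0.
  have dr : dl < r / 2 by near: dl; apply: nbhs_right_lt; rewrite divr_gt0.
  have fy : `|f x - f y| < e / 2.
    by apply: rP; rewrite /ball/=; lra.
  have ft : `|f x - f t| < e / 2.
    by apply: rP; rewrite /ball/=; have := ler_distD y x t; rewrite (distrC y t); lra.
  by have := ler_distD (f x) (f t) (f y); rewrite (distrC (f t) (f x)); lra.
exists (dl / 2); first by rewrite divr_gt0.
move=> x t xab; apply: (dlP (dl / 2)) => //=.
  by rewrite /ball/= sub0r normrN gtr0_norm ?divr_gt0//; lra.
by rewrite divr_gt0.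
Unshelve. all: by end_near. Qed.

End uniform_continuity.

Lemma cvg_expr2V (R : realType) : (2 ^- n : R) @[n --> \oo] --> (0 : R).
Proof.
under eq_fun do rewrite -exprVn; apply: cvg_expr.
by rewrite gtr0_norm ?invr_gt0// invf_lt1// ltr1n.
Qed.

Section first_entry.
Context (R : realType) (f : R -> R).
Hypotheses (cf : continuous f) (f0 : 0 < f 0).
Hypothesis (fneg : exists2 t : R, 0 <= t & f t < 0).
Local Notation leb := (@lebesgue_measure R).

(** The sigma of the overview. The strict inequality makes the condition open, so that a fine enough
    grid detects the entry; a path that merely touches 0 could escape every grid. *)
Definition entry : R := inf [set t : R | 0 <= t /\ f t < 0].

Let S := [set t : R | 0 <= t /\ f t < 0].

Let hinfS : has_inf S.
Proof.
case: fneg => t t0 ft; split; first by exists t.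
by exists 0 => s [].
Qed.

Lemma entry_ge0 : 0 <= entry.
Proof. by apply: lb_le_inf; [exact: hinfS.1|move=> t []]. Qed.

Lemma entry_le (t : R) : 0 <= t -> f t < 0 -> entry <= t.
Proof. by move=> t0 ft; apply: ge_inf; [exact: hinfS.2|]. Qed.

Lemma entry_approx (e : R) : 0 < e -> exists t : R, [/\ entry <= t, t < entry + e & f t < 0].
Proof.
move=> e0; have [t [t0 ft] te] := inf_adherent e0 hinfS.
by exists t; split => //; exact: entry_le.
Qed.

Lemma before_entry (t : R) : 0 <= t <= entry -> 0 <= f t.
Proof.
move=> /andP[t0 te]; rewrite leNgt; apply/negP => ft.
have tE : t = entry by apply/eqP; rewrite eq_le te entry_le.
have t_gt0 : 0 < t.
  by rewrite lt_def t0 andbT; apply/eqP => t00; move: ft; rewrite t00 ltNge (ltW f0).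
have /cvgrPdist_lt/(_ (- f t)) := @cf t; rewrite oppr_gt0 => /(_ ft).
move=> /nbhs_ballP[r /= r0 rP].
pose s := Num.max 0 (t - r / 2).
have st : s < t by rewrite /s gt_max t_gt0/=; lra.
have sr : `|t - s| < r.
  rewrite gtr0_norm ?subr_gt0//.
  have : t - r / 2 <= s by rewrite /s le_max lexx orbT.
  by lra.
have := rP s sr; rewrite /= distrC => /ltr_normlW fs.
have : entry <= s by apply: entry_le; [rewrite /s le_max lexx|lra].
by rewrite -tE leNgt st.
Qed.

(** The stopping index on the grid of mesh 2^-n with 4^n steps, as provided by [stoppedP]. *)
Variables (kap : nat -> nat).
Hypothesis kap_pos : forall n i, (i < kap n)%N -> 0 <= f (i%:R * 2 ^- n).
Hypothesis kap_neg : forall n, (kap n < 4 ^ n)%N -> f ((kap n)%:R * 2 ^- n) < 0.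

Let h0 n : 0 < 2 ^- n :> R.
Proof. by rewrite invr_gt0 exprn_gt0. Qed.

Let h_lt (r : R) : 0 < r -> \forall n \near \oo, 2 ^- n < r.
Proof.
move=> r0; move/cvgrPdist_lt : (@cvg_expr2V R) => /(_ r r0); apply: filterS => n.
by rewrite sub0r normrN gtr0_norm ?h0.
Qed.

Lemma kap_near (e : R) : 0 < e ->
  \forall n \near \oo, (kap n < 4 ^ n)%N /\ (kap n)%:R * 2 ^- n <= entry + e.
Proof.
move=> e0; have e20 : 0 < e / 2 by rewrite divr_gt0.
have [t [te te2 ft]] := entry_approx e20.
have t0 : 0 <= t := le_trans entry_ge0 te.
have /cvgrPdist_lt/(_ (- f t)) := @cf t; rewrite oppr_gt0 => /(_ ft).
move=> /nbhs_ballP[r /= r0 rP].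
have ee0 : 0 < entry + e by rewrite (lt_le_trans e0)// lerDr entry_ge0.
near=> n.
have hr : 2 ^- n < r by near: n; exact: h_lt.
have he : 2 ^- n < e / 2 by near: n; exact: h_lt.
(* 2^n is the horizon of the grid, so stopping before it means [kap n < 4 ^ n]. *)
have eh : entry + e < (2 ^- n)^-1.
  rewrite -(invrK (entry + e)) ltf_pV2 ?posrE ?invr_gt0 ?h0//.
  by near: n; apply: h_lt; rewrite invr_gt0.
set h : R := 2 ^- n in hr he eh *.
(* The first grid point after [t]: close enough to [t] for the path to be negative there, and still
   at most [entry + e]. *)
pose j := (Num.trunc (t / h)).+1.
have /andP[j1 j2] := truncn_itv (divr_ge0 t0 (ltW (h0 n))).
have tj : t < j%:R * h by rewrite -ltr_pdivrMr ?h0.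
have jt : j%:R * h <= t + h.
  by rewrite -natr1 mulrDl mul1r lerD2r -ler_pdivlMr ?h0.
have fj : f (j%:R * h) < 0.
  have : `|t - j%:R * h| < r by rewrite distrC gtr0_norm ?subr_gt0//; lra.
  by move=> /rP; rewrite /= distrC => /ltr_normlW; lra.
have kj : (kap n <= j)%N.
  by rewrite leqNgt; apply/negP => /kap_pos; rewrite leNgt fj.
have kh : (kap n)%:R * h <= j%:R * h by rewrite ler_pM2r ?h0// ler_nat.
split; last by lra.
have : (kap n)%:R * h < h^-1 by lra.
rewrite -ltr_pdivlMr ?h0// -(ltr_nat R) natrX.
by rewrite /h invrK (_ : 4%:R = 2 * 2 :> R) ?exprMn// -natrM.
Unshelve. all: by end_near. Qed.

Lemma cvg_kap : (kap n)%:R * 2 ^- n @[n --> \oo] --> entry.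
Proof.
apply/cvgrPdist_le => e e0; near=> n.
have [k4 ke] : (kap n < 4 ^ n)%N /\ (kap n)%:R * 2 ^- n <= entry + e.
  by near: n; exact: kap_near.
have : entry <= (kap n)%:R * 2 ^- n.
  by apply: entry_le; rewrite ?kap_neg// mulr_ge0// ltW ?h0.
by rewrite distrC => ek; rewrite ger0_norm ?subr_ge0//; lra.
Unshelve. all: by end_near. Qed.

Lemma cvg_level : f ((kap n)%:R * 2 ^- n) @[n --> \oo] --> (0 : R).
Proof.
have cfk : f ((kap n)%:R * 2 ^- n) @[n --> \oo] --> f entry.
  by apply: (cvg_comp (fun n => (kap n)%:R * 2 ^- n) f cvg_kap); exact: cf.
rewrite [X in _ --> X](_ : 0 = f entry)//.
apply/eqP; rewrite eq_le before_entry ?entry_ge0 ?lexx//=.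
apply: cvgr_to_le cfk _; near=> n; apply/ltW/kap_neg.
near: n; have [] := kap_near ltr01 => //.
by move=> N _ NP; exists N => // n /NP[].
Unshelve. all: by end_near. Qed.

(* Starting at -1 makes [F] differentiable at 0 as well. *)
Let F (y : R) : R := (\int[leb]_(t in `[(- 1)%R, y]) f t)%R.

Let dF (y : R) : -1 < y -> is_derive y 1 F (f y).
Proof.
move=> y1.
have intf : leb.-integrable `[-1, y + 1] (EFin \o f).
  apply: continuous_compact_integrable; first exact: segment_compact.
  exact: continuous_subspaceT.
have [|d1 d2] := @continuous_FTC1_closed _ f (-1) y (y + 1) _ intf y1 (@cf y).
  by rewrite ltrDl.
by split; [exact: d1|rewrite -derive1E; exact: d2].
Qed.

Let cF (y : R) : -1 < y -> {for y, continuous F}.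
Proof.
move=> y1; apply/differentiable_continuous/derivable1_diffP.
by case: (dF y1).
Qed.

Let FE (y : R) : 0 <= y ->
  (\int[leb]_(t in `[0%R, y]) (f t)%:E = (F y - F 0)%:E)%E.
Proof.
rewrite le_eqVlt => /predU1P[<-|y0].
  by rewrite set_itv1 integral_set1 subrr.
rewrite EFinB; apply: continuous_FTC2 => //.
- exact: continuous_subspaceT.
- split.
  + move=> z; rewrite in_itv/= => /andP[z0 _].
    by have [] := dF (lt_trans (ltrN10 R) z0).
  + by apply/cvg_at_right_filter/cF; rewrite ltrN10.
  + by apply/cvg_at_left_filter/cF; rewrite (lt_trans (ltrN10 R)).
- move=> z; rewrite in_itv/= => /andP[z0 _].
  by rewrite derive1E; have [_ ->] := dF (lt_trans (ltrN10 R) z0).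
Qed.

(** By the mean value theorem [F] increases over a cell by its length times some [f c], so replacing
    [c] by the left end costs at most the length times e. *)
Let riemann n k (e : R) : (forall x t : R, x \in `[0, k%:R * 2 ^- n] -> `|t - x| <= 2 ^- n ->
    `|f t - f x| <= e) ->
  `|F (k%:R * 2 ^- n) - F 0 - 2 ^- n * \sum_(i < k) f (i%:R * 2 ^- n)|
    <= k%:R * 2 ^- n * e.
Proof.
set h := 2 ^- n; elim: k => [|k ih] ek.
  by rewrite mul0r subrr big_ord0 mulr0 subrr normr0 mul0r.
have kk : k%:R * h <= k.+1%:R * h by rewrite ler_pM2r ?h0// ler_nat.
have k0 : 0 <= k%:R * h by rewrite mulr_ge0// ltW// h0.
have [z|//|] := @MVT_segment R F f (k%:R * h) (k.+1%:R * h) kk.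
- rewrite in_itv/= => /andP[zk _]; apply: dF.
  by rewrite (lt_le_trans (ltrN10 R))// (le_trans k0)// ltW.
- apply: continuous_in_subspaceT => z; rewrite inE/= in_itv/= => /andP[zk _].
  by apply: cF; rewrite (lt_le_trans (ltrN10 R))// (le_trans k0).
move=> c; rewrite in_itv/= => /andP[ck1 ck2] Fc.
have dh : k.+1%:R * h - k%:R * h = h by rewrite -natr1; ring.
rewrite dh in Fc.
have fck : `|f c - f (k%:R * h)| <= e.
  apply: ek; first by rewrite in_itv/= k0.
  by rewrite ger0_norm ?subr_ge0//; lra.
rewrite big_ord_recr/= (_ : F (k.+1%:R * h) - F 0 -
    h * (\sum_(i < k) f (i%:R * h) + f (k%:R * h)) =
  (F (k%:R * h) - F 0 - h * \sum_(i < k) f (i%:R * h)) +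
  h * (f c - f (k%:R * h))); last by rewrite mulrBr [h * f c]mulrC -Fc; ring.
rewrite (_ : k.+1%:R * h * e = k%:R * h * e + h * e); last by rewrite -natr1; ring.
apply: (le_trans (ler_normD _ _)); apply: lerD.
  apply: ih => x t xk; apply: ek; move: xk; rewrite !in_itv/= => /andP[-> xk]/=.
  exact: le_trans kk.
by rewrite normrM (gtr0_norm (h0 n)) ler_pM2l ?h0.
Qed.

Let cvg_riemann_error : F ((kap n)%:R * 2 ^- n) - F 0 -
   2 ^- n * (\sum_(i < kap n) f (i%:R * 2 ^- n)) @[n --> \oo] --> (0 : R).
Proof.
apply/cvgrPdist_le => e e0.
have E1 : 0 < entry + 1 by rewrite (lt_le_trans ltr01)// lerDr entry_ge0.
(* The sum eventually covers a length of at most [entry + 1], over which this local error adds up to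
   e. *)
have e1 : 0 < e / (entry + 1) by rewrite divr_gt0.
have [dl dl0 dlP] := continuous_segment_unif 0 (entry + 1) cf e1.
near=> n; rewrite sub0r normrN.
have [_ ke] : (kap n < 4 ^ n)%N /\ (kap n)%:R * 2 ^- n <= entry + 1.
  by near: n; exact: kap_near.
have hdl : 2 ^- n < dl by near: n; exact: h_lt.
apply: (@le_trans _ _ ((kap n)%:R * 2 ^- n * (e / (entry + 1)))).
  apply: riemann => x t; rewrite in_itv/= => /andP[x0 xk] tx.
  apply/ltW/dlP; last exact: le_lt_trans hdl.
  by rewrite in_itv/= x0 (le_trans xk).
by rewrite mulrA ler_pdivrMr// mulrC ler_pM2l.
Unshelve. all: by end_near. Qed.

Lemma cvg_riemann :
  2 ^- n * (\sum_(i < kap n) f (i%:R * 2 ^- n)) @[n --> \oo] -->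
  fine (\int[leb]_(t in `[0%R, entry]) (f t)%:E)%E.
Proof.
rewrite FE ?entry_ge0//= -[X in _ --> X]subr0.
have cFk : F ((kap n)%:R * 2 ^- n) - F 0 @[n --> \oo] --> F entry - F 0.
  apply: cvgB; last exact: cvg_cst.
  apply: (cvg_comp (fun n => (kap n)%:R * 2 ^- n) F cvg_kap).
  by apply: cF; rewrite (lt_le_trans (ltrN10 R))// entry_ge0.
apply: cvg_trans (cvgB cFk cvg_riemann_error).
by apply: near_eq_cvg; near=> n; rewrite !fctE/= subKr.
Unshelve. all: by end_near. Qed.

Lemma integral_entry_fin_num :
  (\int[leb]_(t in `[0%R, entry]) (f t)%:E)%E \is a fin_num.
Proof. by rewrite FE ?entry_ge0. Qed.

End first_entry.

(** * Passage to the limit *)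

Section lower_integral.
Local Open Scope ereal_scope.
Context d (T : measurableType d) (R : realType).
Variable mu : {measure set T -> \bar R}.

Import HBNNSimple.

(* The integral of a nonnegative function is a supremum over the simple functions
   below it, so no measurability is needed here. *)
Lemma ge0_le_integral_off_null (f g : T -> \bar R) (N : set T) :
  measurable N -> mu N = 0 -> (forall x, 0 <= f x) -> (forall x, 0 <= g x) ->
  (forall x, ~ N x -> f x <= g x) -> \int[mu]_x f x <= \int[mu]_x g x.
Proof.
move=> mN N0 f0 g0 fg.
rewrite (ge0_integralTE _ f0) (ge0_integralTE _ g0).
apply: ge_ereal_sup => _ [h /= hf <-].
apply: ereal_sup_ubound; exists (proj_nnsfun h (measurableC mN)) => /=.
  move=> x; rewrite /= mindicE; case: (boolP (x \in ~` N)).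
    by rewrite inE /= mulr1 => nN; apply: (le_trans (hf x)); exact: fg.
  by rewrite mulr0.
rewrite -(integralT_nnsfun mu (proj_nnsfun h (measurableC mN))).
rewrite -(integralT_nnsfun mu h).
apply: ge0_ae_eq_integral => //.
- exact/measurable_EFinP.
- exact/measurable_EFinP.
- by move=> x _; rewrite lee_fin.
- by move=> x _; rewrite lee_fin.
exists N; split => // x /= nx; apply: contrapT => nN; apply: nx => _.
by rewrite mindicE mem_set// mulr1.
Qed.

(** The negative parts vanish off a null set, so both integrals reduce to those of the positive
    parts. It is applied to tau A, whose measurability is not known. *)
Lemma ae_le_integral (f g : T -> \bar R) :
  {ae mu, forall x, 0 <= f x <= g x} -> \int[mu]_x f x <= \int[mu]_x g x.
Proof.
move=> [N [mN N0 fgN]].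
have fg x : ~ N x -> 0 <= f x <= g x.
  by move=> nN; apply: contrapT => nfg; apply: nN; exact: fgN.
have neg0 (k : T -> \bar R) : (forall x, ~ N x -> 0 <= k x) ->
    \int[mu]_x k^\- x = 0.
  move=> k0; apply/eqP; rewrite eq_le integral_ge0// andbT.
  rewrite -[leRHS](integral0 mu setT).
  apply: (ge0_le_integral_off_null mN N0) => // x nN.
  by rewrite funenegE ge_max lexx leeNl oppe0 k0.
rewrite integralE [leRHS]integralE neg0 => [|x /fg /andP[]//].
rewrite neg0 => [|x /fg /andP[]]; last exact: le_trans.
rewrite !sube0; apply: (ge0_le_integral_off_null mN N0) => // x /fg /andP[f0 fgx].
by rewrite !funeposE ge_max !le_max fgx lexx orbT.
Qed.

End lower_integral.

Lemma cvg_mart (R : realType) (mu : R) (h y s t : R^nat) (y' s' t' : R) :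
  h n @[n --> \oo] --> (0 : R) -> y n @[n --> \oo] --> y' ->
  s n @[n --> \oo] --> s' -> t n @[n --> \oo] --> t' ->
  mart mu (h n) (y n, s n, t n) @[n --> \oo] --> mart mu 0 (y', s', t').
Proof.
move=> ch cy cs ct; rewrite /mart.
have cX k : y n ^+ k @[n --> \oo] --> y' ^+ k.
  by apply: (cvg_comp y (fun z => z ^+ k) cy); exact: exprn_continuous.
apply: cvgD; last by apply: cvgM; [exact: cy|exact: cvg_cst].
apply: cvgD; last first.
  apply: cvgM; last exact: cX.
  by apply: cvgD; [exact: cvg_cst|apply: cvgM; [exact: ch|exact: cvg_cst]].
apply: cvgD; last by apply: cvgM; [exact: cX|exact: cvg_cst].
apply: cvgD; last first.
  by apply: cvgM; [apply: cvgM; [exact: cs|exact: cy]|exact: cvg_cst].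
apply: cvgD; first by apply: cvgM; [exact: ct|exact: cs].
apply: cvgM; first exact: ct.
apply: cvgD; first by apply: cvgM; [exact: cX|exact: cvg_cst].
apply: cvgM; last exact: cy.
by apply: cvgD; [exact: cvg_cst|apply: cvgM; [exact: ch|exact: cvg_cst]].
Qed.

Section stopped_limit.
Context (R : realType) (d : measure_display) (T : measurableType d).
Variables (P : probability T R) (B : R -> {RV P >-> R}).
Hypothesis hB : standard_brownian_motion B.
Variable (mu : R).
Hypotheses (mu0 : 0 < mu).
Local Notation leb := (@lebesgue_measure R).

(** Frozen at negative times, so that it is continuous on the whole line. *)
Definition right_path (y : R) (w : T) (t : R) : R := bpath B y mu w (Num.max t 0).

Lemma continuous_right_path y w :
  {within `[0, +oo[, continuous (fun t : R => B t w)} ->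
  continuous (right_path y w).
Proof.
move=> cB t.
have cm : Num.max s 0 @[s --> t] --> Num.max t 0.
  by apply: (@continuous_max _ _ id (cst 0)); [exact: cvg_id|exact: cvg_cst].
apply: cvgD.
  apply: cvgB; first exact: cvg_cst.
  by apply: cvgM; [exact: cvg_cst|exact: cm].
apply: cvgB; last exact: cvg_cst.
move/subspace_continuousP : cB => /(_ (Num.max t 0)).
rewrite /= in_itv/= andbT le_max lexx orbT => /(_ isT) cB.
apply: cvg_trans cB => U /= cU.
have : \forall s \near t, `[0, +oo[%classic (Num.max s 0) ->
  U (B (Num.max s 0) w) := cm _ cU.
apply: (@filterS _ (nbhs t)) => s; apply.
by rewrite /= in_itv/= andbT le_max lexx orbT.
Qed.

(** Where the dominating function is finite, the position at the horizon 2^n is at most y + m - mu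
    2^n / 2, which is negative for large n. The null set does not depend on [y]. *)
Lemma ae_right_path_neg : {ae P, forall w, forall y,
  exists2 t : R, 0 <= t & right_path y w t < 0}.
Proof.
have [G iG GP] := exists_dominating hB mu0.
have := integrable_ae measurableT iG; apply: filterS => w /(_ I) Gw y.
have [Gy|[m [_ Bm]]] := GP w; first by rewrite Gy in Gw.
have [n yn] : exists n : nat, y + m%:R < mu / 2 * 2 ^+ n.
  pose r := `|y + m%:R| / (mu / 2).
  have r0 : 0 <= r by rewrite /r divr_ge0// ltW// divr_gt0.
  exists (Num.bound r); rewrite mulrC -ltr_pdivrMr ?divr_gt0//.
  apply: (@le_lt_trans _ _ r).
    by rewrite /r ler_pM2r ?invr_gt0 ?divr_gt0// ler_norm.
  by rewrite (lt_trans (archi_boundP r0))// -natrX ltr_nat ltn_expl.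
exists ((4 ^ n)%:R * 2 ^- n); first by rewrite mulr_ge0// invr_ge0 exprn_ge0.
have t0 : 0 <= (4 ^ n)%:R * 2 ^- n :> R by rewrite mulr_ge0// invr_ge0 exprn_ge0.
rewrite /right_path (max_idPl t0) /bpath.
have := ler_normlW (Bm n _ (leqnn _)).
have -> : (4 ^ n)%:R * 2 ^- n = 2 ^+ n :> R.
  by rewrite (_ : 4 = 2 * 2)%N// expnMn natrM natrX mulfK// expf_neq0.
by lra.
Qed.

Let M (y : R) n w := (mart mu (2 ^- n) (stopped B y mu (2 ^- n) (4 ^ n) w))%:E.

Lemma cvg_mart_stopped y w : 0 < y -> continuous (right_path y w) ->
  (exists2 t : R, 0 <= t & right_path y w t < 0) ->
  M y n w @[n --> \oo] --> ((entry (right_path y w))%:E *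
    \int[leb]_(t in `[0%R, entry (right_path y w)]) (right_path y w t)%:E)%E.
Proof.
move=> y0; set f := right_path y w => cf fneg.
have fE n i : bpath B y mu w (i%:R * 2 ^- n) = f (i%:R * 2 ^- n).
  rewrite /f /right_path (max_idPl _)// mulr_ge0// invr_ge0 exprn_ge0//.
have f0 : 0 < f 0 by rewrite /f /right_path maxxx /bpath mulr0 subrr subr0 addr0.
pose kap n := projT1 (cid (stoppedP B y mu (2 ^- n) (4 ^ n) w)).
have kapP n := projT2 (cid (stoppedP B y mu (2 ^- n) (4 ^ n) w)).
have kap_pos n i : (i < kap n)%N -> 0 <= f (i%:R * 2 ^- n).
  by move=> ik; have [_ _ /(_ i ik) + _] := kapP n; rewrite fE.
have kap_neg n : (kap n < 4 ^ n)%N -> f ((kap n)%:R * 2 ^- n) < 0.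
  by move=> ik; have [_ _ _ /(_ ik)] := kapP n; rewrite fE.
have ME n : M y n w = (mart mu (2 ^- n) (f ((kap n)%:R * 2 ^- n),
    2 ^- n * \sum_(i < kap n) f (i%:R * 2 ^- n), (kap n)%:R * 2 ^- n))%:E.
  have [_ zE _ _] := kapP n; rewrite /M zE fE -/(kap n).
  by under eq_bigr do rewrite fE.
have cy := cvg_level cf f0 fneg kap_pos kap_neg.
have ct := cvg_kap cf fneg kap_pos kap_neg.
have cs := cvg_riemann cf fneg kap_pos kap_neg.
have fA := integral_entry_fin_num cf fneg.
rewrite -(fineK fA) -EFinM.
set A := fine _ in cs *; set sg := entry f in ct *.
under eq_fun do rewrite ME.
apply/cvg_EFin; first by near=> n.
(* The overshoot vanishes in the limit, and at position 0 only the term t s of [mart] survives. *)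
rewrite (_ : sg * A = mart mu 0 (0, A, sg)); first exact: cvg_mart (@cvg_expr2V R) cy cs ct.
by rewrite /mart !expr0n/= !(mul0r, mulr0, addr0).
Unshelve. all: by end_near. Qed.

(** [g] is the upper limit of the stopped martingales: measurable by construction, it stands in for
    sigma A', with which it agrees almost surely. Its integral is the limit of the constant means,
    [mart] at the starting state as h tends to 0. *)
Lemma integral_entry (y : R) : 0 < y -> exists g : T -> \bar R,
  [/\ {ae P, forall w, g w = ((entry (right_path y w))%:E *
    \int[leb]_(t in `[0%R, entry (right_path y w)]) (right_path y w t)%:E)%E} &
  (\int[P]_w g w = (y ^+ 3 / (2 * mu ^+ 2) + y ^+ 2 / mu ^+ 3 + y / mu ^+ 4)%:E)%E].
Proof.
move=> y0; pose g w := limn_esup (fun n => M y n w).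
have cM : {ae P, forall w, M y n w @[n --> \oo] --> ((entry (right_path y w))%:E *
    \int[leb]_(t in `[0%R, entry (right_path y w)]) (right_path y w t)%:E)%E}.
  have := ae_right_path_neg; have := sbm_continuous_paths hB.
  apply: filterS2 => w cB neg; apply: cvg_mart_stopped => //.
  exact: continuous_right_path.
exists g; split.
  by apply: filterS cM => w /cvg_limn_einf_sup[].
have [G iG GP] := mart_dominated hB y0 mu0.
have mM n : measurable_fun setT (M y n) by exact: measurable_mart_stopped.
have [|||||_ _ cvI] := @dominated_convergence _ _ _ P setT measurableT (M y) g G.
- exact: mM.
- exact: measurable_fun_limn_esup.
- apply: filterS cM => w cw _; have [_ gE] := cvg_limn_einf_sup cw.
  by rewrite /g gE.
- exact: iG.
- by apply: aeW => w n _; exact: GP.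
apply/esym/(cvg_unique _ _ cvI) => //.
rewrite (_ : [sequence _]_n = fun n => (mart mu (2 ^- n) (y, 0, 0))%:E); last first.
  by apply/funext => n; rewrite /= integral_mart_stopped.
apply/cvg_EFin; first by near=> n.
rewrite (_ : _ + _ = mart mu 0 (y, 0, 0)).
  exact: cvg_mart (@cvg_expr2V R) (cvg_cst y) (cvg_cst 0) (cvg_cst 0).
by rewrite /mart; field; rewrite gt_eqF.
Unshelve. all: by end_near. Qed.

End stopped_limit.

(** * Comparison of the passage time with strict entry times *)

Section sandwich.
Context (R : realType) (d : measure_display) (T : measurableType d).
Variables (P : probability T R) (B : R -> {RV P >-> R}).
Variable (mu : R).
Local Notation leb := (@lebesgue_measure R).
Variables (x : R) (w : T).
Hypotheses (x0 : 0 < x) (B0 : B 0 w = 0).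
Hypothesis cB : {within `[0, +oo[, continuous (fun t : R => B t w)}.
Hypothesis neg : forall y, exists2 t : R, 0 <= t & right_path B mu y w t < 0.

Local Notation f y := (right_path B mu y w).
Local Notation phi := (drifted_path B x mu w).
Local Notation area y := (\int[leb]_(t in `[0%R, entry (f y)]) (f y t)%:E)%E.
Local Notation tau := (first_passage_time phi).
Local Notation A := (first_passage_area phi).

Let fE y t : 0 <= t -> f y t = phi t - (x - y).
Proof.
move=> t0; rewrite /right_path (max_idPl t0) /bpath /drifted_path B0; ring.
Qed.

Let f0 y : 0 < y -> 0 < f y 0.
Proof. by move=> y0; rewrite /right_path maxxx /bpath mulr0 subrr subr0 addr0. Qed.

Let cf y : continuous (f y).
Proof. exact: continuous_right_path. Qed.

Let mf y D : measurable_fun D (fun t => (f y t)%:E).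
Proof.
apply: measurable_funTS; apply/measurable_EFinP.
by apply: continuous_measurable_fun; exact: cf.
Qed.

Let tau_le : (tau <= (entry (f x))%:E)%E.
Proof.
apply/lee_addgt0Pr => e e0.
have [t [te te2 ft]] := entry_approx (neg x) e0.
have t0 : 0 <= t := le_trans (entry_ge0 (neg x)) te.
apply: (@le_trans _ _ t%:E); last by rewrite -EFinD lee_fin ltW.
apply: ereal_inf_lbound; exists t => //=; split.
  rewrite lt_def t0 andbT; apply/eqP => t00; move: ft.
  by rewrite t00 ltNge ltW// f0.
by have := ft; rewrite fE// subrr subr0 => /ltW.
Qed.

Let tau_ge0 : (0 <= tau)%E.
Proof. by apply: le_ereal_inf_tmp => _ [t [/ltW t0 _] <-]; rewrite lee_fin. Qed.

Let tauE : tau = (fine tau)%:E.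
Proof. by rewrite fineK// fin_numElt (lt_le_trans _ tau_ge0) ?ltNyr// (le_lt_trans tau_le) ?ltry. Qed.

Let fine_tau_ge0 : 0 <= fine tau.
Proof. exact: fine_ge0. Qed.

Let fine_tau_le : fine tau <= entry (f x).
Proof. by rewrite -lee_fin -tauE. Qed.

Let areaE : A = (\int[leb]_(t in `[0%R, fine tau]) (f x t)%:E)%E.
Proof.
rewrite /first_passage_area (_ : mkset _ = `[0, fine tau]%classic); last first.
  apply/seteqP; split => t /=; rewrite in_itv/= tauE lee_fin.
    by move=> [-> ->].
  by move=> /andP.
apply: eq_integral => t; rewrite inE/= in_itv/= => /andP[t0 _].
by rewrite fE// subrr subr0.
Qed.

Let fx_ge0 t : t \in `[0, fine tau] -> 0 <= f x t.
Proof.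
rewrite in_itv/= => /andP[t0 tt]; apply: (before_entry _ _ (neg x)).
- exact: cf.
- exact: f0.
- by rewrite t0 (le_trans tt).
Qed.

Let A_ge0 : (0 <= A)%E.
Proof. by rewrite areaE; apply: integral_ge0 => t tt; rewrite lee_fin fx_ge0. Qed.

(** Times of negativity are passage times, so tau <= sigma, and the path stays nonnegative up to
    sigma, so the area only grows between the two. *)
Lemma passage_product_le : (0 <= tau * A <= (entry (f x))%:E * area x)%E.
Proof.
rewrite mule_ge0//=; apply: lee_pmul => //.
rewrite areaE; apply: ge0_subset_integral => //=.
- exact: mf.
- move=> t; rewrite in_itv/= => te; rewrite lee_fin.
  case/andP: te => ta tb; apply: (before_entry _ _ (neg x)).
  - exact: cf.
  - exact: f0.
  - by apply/andP; split.
- by apply: subset_itvl; rewrite bnd_simp.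
Qed.

(** The path from [y] is the path from [x] lowered by x - y > 0: whenever the latter is at most 0,
    the former is strictly negative. Hence its entry comes no later than tau, and its area is
    smaller. *)
Lemma passage_product_ge y : 0 < y -> y < x ->
  (0 <= (entry (f y))%:E * area y <= tau * A)%E.
Proof.
move=> y0 yx.
have fy0 t : t \in `[0, entry (f y)] -> 0 <= f y t.
  rewrite in_itv/= => te.
  case/andP: te => ta tb; apply: (before_entry _ _ (neg y)).
  - exact: cf.
  - exact: f0.
  - by apply/andP; split.
have ey0 : 0 <= entry (f y) := entry_ge0 (neg y).
have a0 : (0 <= area y)%E.
  by apply: integral_ge0 => t tt; rewrite lee_fin fy0.
have et : entry (f y) <= fine tau.
  rewrite -lee_fin -tauE; apply: le_ereal_inf_tmp => _ [t [/ltW t0 pt] <-].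
  by rewrite lee_fin; apply: (entry_le (neg y)) => //; rewrite fE//; lra.
rewrite mule_ge0//=; apply: lee_pmul => //.
  by rewrite tauE lee_fin.
rewrite areaE; apply: (@le_trans _ _ (\int[leb]_(t in `[0%R, entry (f y)]) (f x t)%:E)%E).
  apply: ge0_le_integral => //.
  - exact: mf.
  - exact: mf.
  - move=> t; rewrite /= in_itv/= => /andP[t0 _].
    by rewrite lee_fin !fE//; lra.
apply: ge0_subset_integral => //=.
- exact: mf.
- by apply: subset_itvl; rewrite bnd_simp.
Qed.

End sandwich.

Theorem mainTheorem2 (R : realType) (d : measure_display) (T : measurableType d)
    (P : probability T R) (B : R -> {RV P >-> R})
    (hB : standard_brownian_motion B)
    (x mu : R) (hx : 0 < x) (hmu : 0 < mu) :
  (\int[P]_w (first_passage_time (drifted_path B x mu w)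
              * first_passage_area (drifted_path B x mu w)))%E
  = (x ^+ 3 / (2 * mu ^+ 2) + x ^+ 2 / mu ^+ 3 + x / mu ^+ 4)%:E.
Proof.
pose v (y : R) := y ^+ 3 / (2 * mu ^+ 2) + y ^+ 2 / mu ^+ 3 + y / mu ^+ 4.
set I := integral _ _ _; rewrite -/(v x).
have aeB : {ae P, forall w, B 0 w = 0 /\
    {within `[0, +oo[, continuous (fun t : R => B t w)}}.
  by apply: filterS2 (sbm_start hB) (sbm_continuous_paths hB) => w.
have I_le : (I <= (v x)%:E)%E.
  have [g [ag <-]] := integral_entry hB hmu hx.
  apply: ae_le_integral.
  have := aeB; have := ae_right_path_neg hB hmu; move: ag.
  apply: filterS3 => w -> neg [B0 cB].
  exact: passage_product_le.
have I_ge y : 0 < y -> y < x -> ((v y)%:E <= I)%E.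
  move=> y0 yx; have [g [ag <-]] := integral_entry hB hmu y0.
  apply: ae_le_integral.
  have := aeB; have := ae_right_path_neg hB hmu; move: ag.
  apply: filterS3 => w -> neg [B0 cB].
  exact: passage_product_ge.
have Ifin : I = (fine I)%:E.
  have x2 : 0 < x / 2 by rewrite divr_gt0.
  rewrite fineK// fin_numElt (le_lt_trans I_le) ?ltry// andbT.
  by apply: lt_le_trans (I_ge _ x2 _); rewrite ?ltNyr//; lra.
apply/eqP; rewrite eq_le I_le/= Ifin lee_fin.
(* The lower bounds [I_ge] reach [v x] as y increases to x. *)
have cv : v y @[y --> x^'-] --> v x.
  apply: cvg_at_left_filter; rewrite /v.
  by apply: cvgD; [apply: cvgD|]; apply: cvgM; [exact: exprn_continuous|exact: cvg_cst|exact: exprn_continuous|exact: cvg_cst|exact: cvg_id|exact: cvg_cst].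
apply: cvgr_to_le cv _; near=> y; rewrite -lee_fin -Ifin; apply: I_ge.
- by near: y; exact: nbhs_left_gt.
- by near: y; exact: nbhs_left_lt.
Unshelve. all: by end_near. Qed.
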